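(* Let $T\in C_{00}$. Then $T$ is reducible if and only if there exist nontrivial subspaces $E\subset\mathcal D_T$, $E_*\subset\mathcal D_{T^*}$ such that $\Theta_T(e^{it})E=E_*$ for almost all $t$.
   Context: A contraction $T$ on a Hilbert space is in $C_{00}$ if $T^n\to0$ and $T^{*n}\to0$ strongly. Subspaces are closed; a nontrivial subspace is one different from $\{0\}$ and from the whole space. $T$ is reducible if there is a nontrivial subspace $M$ such that $M$ and $M^\perp$ are both invariant under $T$. The defect operator of $T$ is $D_T=(I-T^*T)^{1/2}$ and the defect space $\mathcal D_T$ is the closure of its range. The characteristic function of $T$ is $$\Theta_T(z)=-T+zD_{T^*}(I-zT^* )^{-1}D_T\,|\,\mathcal D_T\in\mathcal L(\mathcal D_T,\mathcal D_{T^*}),\qquad |z|<1.$$ It is a contractive analytic function; $\Theta_T(e^{it})$ denotes its boundary values (strong radial limits), defined for almost all $t$. For $T\in C_{00}$, $\Theta_T(e^{it})$ is unitary for almost all $t$. *)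

(* Defs.v *)
From HB Require Import structures.
From mathcomp Require Import all_boot all_order all_algebra sesquilinear.
From mathcomp Require Import complex.
From mathcomp Require Import all_classical all_reals all_analysis.

Set Implicit Arguments.
Unset Strict Implicit.
Unset Printing Implicit Defensive.

Import Order.TTheory GRing.Theory Num.Theory.
Import numFieldNormedType.Exports.

Local Open Scope classical_set_scope.
Local Open Scope ring_scope.

(* A complex Hilbert space is a complete normed space [H] over [R[i]] with an
   inner product [dot], linear in its first argument, inducing the norm. *)
Definition hilbert (R : realType) (H : completeNormedModType R[i])
    (dot : {dot H for Num.conj}) : Prop :=
  forall x : H, `|x| ^+ 2 = dot x x.

Section Operators.
Context {R : realType} {H : completeNormedModType R[i]}.
Variable dot : {dot H for Num.conj}.

Implicit Types (M W E : set H) (A T : H -> H).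

Definition closed_subspace M : Prop := GRing.submod_closed (mem M) /\ closed M.

(* The subspace [M] is different from [{0}] and from the whole space [W]. *)
Definition nontrivial_in W M : Prop := M <> [set 0] /\ M <> W.

Definition orthocomp M : set H := [set y | forall x, M x -> dot x y = 0].

Definition bounded_op A : Prop := linear A /\ continuous A.

Definition contraction T : Prop := linear T /\ forall x, `|T x| <= `|x|.

(* The adjoint exists (Riesz) and is unique as soon as [A] is bounded; for
   other [A] the value has no meaning. *)
Definition adjoint A : H -> H :=
  xget (fun=> 0) [set B : H -> H | forall x y, dot (A x) y = dot x (B y)].

Definition reducible T : Prop :=
  exists M : set H, [/\ closed_subspace M, nontrivial_in [set: H] M,
    T @` M `<=` M & T @` orthocomp M `<=` orthocomp M].

Definition C00 T : Prop :=
  [/\ contraction T,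
      forall x : H, iter n T x @[n --> \oo] --> (0 : H) &
      forall x : H, iter n (adjoint T) x @[n --> \oo] --> (0 : H)].

(* In [R[i]], [0 <= c] says that [c] is real and nonnegative. *)
Definition positive_op A : Prop :=
  bounded_op A /\ forall x, 0 <= dot (A x) x.

(* A positive operator has exactly one positive square root; for other [A] the
   value has no meaning. *)
Definition sqrt_op A : H -> H :=
  xget (fun=> 0) [set B : H -> H | positive_op B /\ B \o B = A].

Definition defect_op T : H -> H := sqrt_op (fun x => x - adjoint T (T x)).

Definition defect_space T : set H := closure (range (defect_op T)).

(* For a contraction [T] and [`|z| < 1], [I - z T^*] is bijective, so that
   ['pinv] is its genuine inverse. As an operator between the defect spaces,
   the characteristic function is the restriction of [char_fun T z] to
   [defect_space T]. *)
Definition char_fun T (z : R[i]) (x : H) : H :=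
  - T x + z *: defect_op (adjoint T)
    ('pinv_(fun=> 0) setT (fun y => y - z *: adjoint T y) (defect_op T x)).

Definition radial_char_fun T (t : R) (x : H) (r : R) : H :=
  char_fun T (r%:C * (cos t +i* sin t))%C x.

Definition boundary_char_fun T (t : R) (x : H) : H :=
  lim (radial_char_fun T t x r @[r --> 1^'-]).

(* [lim] is only meaningful when the limit exists, which is therefore part of
   the assertion that the boundary value at [exp(it)] maps [E] onto [E'].
   Existence is only required on [E]: when [H] is separable, the strong radial
   limit exists on the whole defect space for almost all [t], so that this
   changes nothing; without separability this almost everywhere existence may
   fail, but the boundary value on a smaller [E] can still make sense. *)
Definition boundary_maps_onto T (t : R) E (E' : set H) : Prop :=
  (forall x, E x -> cvg (radial_char_fun T t x r @[r --> 1^'-])) /\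
  boundary_char_fun T t @` E = E'.

End Operators.

(* Main.v *)
From HB Require Import structures.
Require Import Defs.
From mathcomp Require Import all_boot all_order all_algebra sesquilinear.
From mathcomp Require Import complex.
From mathcomp Require Import all_classical all_reals all_analysis.
From mathcomp Require Import measurable_realfun ring lra.

Import Order.TTheory GRing.Theory Num.Theory.
Import numFieldNormedType.Exports.

Local Open Scope classical_set_scope.
Local Open Scope ring_scope.

Set Implicit Arguments.
Unset Strict Implicit.
Unset Printing Implicit Defensive.

(** Write [S] for the adjoint of [T], [D] and [D'] for the defect operators of
    [T] and [S], and [Theta] for the characteristic function.  Everything rests
    on three facts about [Theta].

    - Its Taylor coefficients at [x] are [- T x] and [D' S^n D x], and when
      [S^n] tends strongly to [0] their squared norms add up to [|x|^2]
      ([char_coef_sum]); moreover [|Theta(z) x| <= |x|] ([char_fun_contr]).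
    - For a vector-valued power series with square summable coefficients,
      radial limits exist at almost every boundary point ([fatou_radial]).  If
      the function is bounded, they vanish almost everywhere only for the zero
      series ([boundary_zero]), and they have the largest norm allowed when
      the squares of the coefficients add up to the square of the bound
      ([boundary_norm]).
    - The adjoint of [Theta(z)] is the characteristic function of [S] at the
      conjugate point ([char_fun_adjoint]).  Hence, wherever both boundary
      operators exist and are isometric, they are inverse to each other.

    An exceptional null set comes with each vector, so these facts hold
    simultaneously only on separable subspaces.  This costs nothing: the
    smallest closed subspace that contains a given vector and is invariant
    under [T] and [S] is generated by countably many vectors
    ([ae_isometric_cyclic]).  A reducing subspace contains such a cyclic one,
    and when a cyclic one is not the whole space [T] is reducible at once.

    Suppose that [K] is a nontrivial cyclic reducing subspace.  The closures
    of [D K] and [D' K] are exchanged by [Theta] and by the characteristic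
    function of [S], so the boundary operators, being mutually inverse, map one
    onto the other.  They are nontrivial because an invariant subspace on
    which [D] vanishes carries an isometric restriction of [T], which is
    incompatible with [T^n] tending to [0] ([defect_kernel_trivial]).

    Conversely, suppose that the boundary operators map [E] onto [E'] almost
    everywhere and that the whole space is cyclic.  By unitarity they also map
    the complement of [E] into that of [E'], and by uniqueness of power series
    with given boundary values each Taylor coefficient maps [E] into [E'] and
    the complement of [E] into the complement of [E'] ([weak_uniqueness]).
    The vectors [x] with [D T^n x] in [E] and [D' S^n x] in [E'] for all [n]
    then form a reducing subspace ([coefficients_reducible]). *)

(** * Real-valued norms over complex scalars *)

(** The library norm takes its values in the partially ordered field of the
    scalars; estimates are carried out on its real part. *)
Definition nrm {R : realType} {V : normedZmodType R[i]} (x : V) : R :=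
  complex.Re `|x|.

Section RealNorm.
Context {R : realType}.

Section Zmod.
Context {V : normedZmodType R[i]}.
Implicit Types x y : V.

Lemma nrmE x : `|x| = (nrm x)%:C%C.
Proof. by rewrite /nrm RRe_real // normr_real. Qed.

Lemma nrm_ge0 x : 0 <= nrm x.
Proof. by rewrite -ler0c -nrmE. Qed.

Lemma nrm0 : nrm (0 : V) = 0.
Proof. by rewrite /nrm normr0. Qed.

Lemma nrm_eq0 x : (nrm x == 0) = (x == 0).
Proof. by rewrite -[RHS]normr_eq0 nrmE -(inj_eq (@complexI R)). Qed.

Lemma nrm_gt0 x : (0 < nrm x) = (x != 0).
Proof. by rewrite lt_def nrm_ge0 nrm_eq0 andbT. Qed.

Lemma nrmN x : nrm (- x) = nrm x.
Proof. by rewrite /nrm normrN. Qed.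

Lemma nrm_distC x y : nrm (x - y) = nrm (y - x).
Proof. by rewrite -nrmN opprB. Qed.

Lemma nrmD x y : nrm (x + y) <= nrm x + nrm y.
Proof. by rewrite -lecR rmorphD /= -!nrmE ler_normD. Qed.

Lemma nrm_tri x y z : nrm (x - z) <= nrm (x - y) + nrm (y - z).
Proof. by apply: le_trans (nrmD _ _); rewrite addrA subrK. Qed.

Lemma nrm_dist x y : `|nrm x - nrm y| <= nrm (x - y).
Proof.
have := nrmD (y - x) x; have := nrmD (x - y) y; rewrite !subrK (nrm_distC y).
by rewrite ler_norml; lra.
Qed.

Lemma nrm_sum (I : Type) (s : seq I) (P : pred I) (F : I -> V) :
  nrm (\sum_(i <- s | P i) F i) <= \sum_(i <- s | P i) nrm (F i).
Proof.
elim/big_ind2 : _ => // [|x a y b hx hy]; first by rewrite nrm0.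
exact: le_trans (nrmD _ _) (lerD hx hy).
Qed.

End Zmod.

Lemma nrmZ (V : normedModType R[i]) (a : R[i]) (x : V) :
  nrm (a *: x) = nrm a * nrm x.
Proof. by apply: complexI; rewrite rmorphM /= -!nrmE normrZ. Qed.

Lemma nrmM (a b : R[i]) : nrm (a * b) = nrm a * nrm b.
Proof. by apply: complexI; rewrite rmorphM /= -!nrmE normrM. Qed.

Lemma nrmX (a : R[i]) n : nrm (a ^+ n) = nrm a ^+ n.
Proof. by apply: complexI; rewrite rmorphXn /= -!nrmE normrX. Qed.

Lemma nrmC (a : R) : nrm (a%:C)%C = `|a|.
Proof. by rewrite /nrm normc_def /= expr0n /= addr0 sqrtr_sqr. Qed.

Lemma nrm_conj (a : R[i]) : nrm (a^*)%C = nrm a.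
Proof. by case: a => a b; rewrite /nrm !normc_def /= sqrrN. Qed.

Lemma nrm_sqr (z : R[i]) : nrm z ^+ 2 = complex.Re z ^+ 2 + complex.Im z ^+ 2.
Proof. by rewrite /nrm normc_def /= sqr_sqrtr // addr_ge0 // sqr_ge0. Qed.

(** Every limit in a complex normed space becomes a limit of reals, for which
    the order-based tools are available. *)
Lemma cvg_nrmP (T : Type) (F : set_system T) (V : pseudoMetricNormedZmodType R[i])
    {FF : Filter F} (f : T -> V) (l : V) :
  f x @[x --> F] --> l <-> nrm (f x - l) @[x --> F] --> (0 : R).
Proof.
split.
  move=> /cvgrPdist_lt fl; apply/cvgrPdist_lt => e e0.
  have e0' : 0 < e%:C%C by rewrite ltcR.
  near=> x; rewrite sub0r normrN ger0_norm ?nrm_ge0 // nrm_distC -ltcR -nrmE.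
  by near: x; exact: fl.
move=> /cvgrPdist_lt fl; apply/cvgrPdist_lt => e e0.
have eE : e = (complex.Re e)%:C%C by rewrite RRe_real ?gtr0_real.
have e0' : 0 < complex.Re e by rewrite -ltcR -eE.
near=> x; rewrite nrmE eE ltcR nrm_distC.
have -> : nrm (f x - l) = `|0 - nrm (f x - l)|.
  by rewrite sub0r normrN ger0_norm ?nrm_ge0.
by near: x; exact: fl.
Unshelve. all: by end_near. Qed.

Lemma cvg_nrm (T : Type) (F : set_system T) (V : pseudoMetricNormedZmodType R[i])
    {FF : Filter F} (f : T -> V) (l : V) :
  f x @[x --> F] --> l -> nrm (f x) @[x --> F] --> nrm l.
Proof.
move=> /cvg_nrmP fl; apply/cvgrPdist_lt => e e0; near=> x.
rewrite distrC (le_lt_trans (nrm_dist _ _)) //.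
have -> : nrm (f x - l) = `|0 - nrm (f x - l)|.
  by rewrite sub0r normrN ger0_norm ?nrm_ge0.
by near: x; move/cvgrPdist_lt : fl; apply.
Unshelve. all: by end_near. Qed.

Lemma nrm_cauchy_cvg (V : completeNormedModType R[i]) (u : nat -> V) :
  (forall e : R, 0 < e -> exists N, forall n m, (N <= n)%N -> (N <= m)%N ->
     nrm (u n - u m) < e) ->
  exists l : V, u n @[n --> \oo] --> l.
Proof.
move=> hu; have : cvgn u; last by move=> uc; exists (limn u).
apply: cauchy_cvg; apply: cauchy_exP => e e0.
have eE : e = (complex.Re e)%:C%C by rewrite RRe_real ?gtr0_real.
have e0' : 0 < complex.Re e by rewrite -ltcR -eE.
have [N hN] := hu _ e0'.
exists (u N); exists N => // n /= Nn.
rewrite -ball_normE /= nrmE eE ltcR; exact: hN.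
Qed.

End RealNorm.

(** * Inner products and Cauchy-Schwarz *)

Section InnerProduct.
Context {R : realType} {H : completeNormedModType R[i]}.
Variable dot : {dot H for Num.conj}.
Hypothesis hH : hilbert dot.
Implicit Types x y z : H.

(** The real part of the inner product is a symmetric real bilinear form with
    the same norm, which keeps the metric estimates free of conjugations. *)
Definition ip x y : R := complex.Re (dot x y).

Lemma dotDl x y z : dot (x + y) z = dot x z + dot y z.
Proof. by rewrite linearDl. Qed.
Lemma dotDr x y z : dot z (x + y) = dot z x + dot z y.
Proof. by rewrite linearDr. Qed.
Lemma dotZl a x y : dot (a *: x) y = a * dot x y.
Proof. by rewrite linearZl_LR. Qed.
Lemma dotZr a x y : dot x (a *: y) = (a^*)%C * dot x y.
Proof. by rewrite linearZr_LR. Qed.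
Lemma dotNl x y : dot (- x) y = - dot x y.
Proof. by rewrite linearNl. Qed.
Lemma dotNr x y : dot x (- y) = - dot x y.
Proof. by rewrite linearNr. Qed.
Lemma dotBl x y z : dot (x - y) z = dot x z - dot y z.
Proof. by rewrite dotDl dotNl. Qed.
Lemma dotBr x y z : dot z (x - y) = dot z x - dot z y.
Proof. by rewrite dotDr dotNr. Qed.
Lemma dot0l x : dot 0 x = 0. Proof. by rewrite linear0l. Qed.
Lemma dot0r x : dot x 0 = 0. Proof. by rewrite linear0r. Qed.
Lemma dotC x y : dot x y = ((dot y x)^*)%C.
Proof. by rewrite hermC /= expr0 mul1r. Qed.

Lemma dot_eq0C x y : dot x y = 0 -> dot y x = 0.
Proof. by rewrite (dotC y) => ->; rewrite conjc0. Qed.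

Lemma ipDl x y z : ip (x + y) z = ip x z + ip y z.
Proof. by rewrite /ip dotDl raddfD. Qed.
Lemma ipDr x y z : ip z (x + y) = ip z x + ip z y.
Proof. by rewrite /ip dotDr raddfD. Qed.
Lemma ipNl x y : ip (- x) y = - ip x y.
Proof. by rewrite /ip dotNl raddfN. Qed.
Lemma ipNr x y : ip x (- y) = - ip x y.
Proof. by rewrite /ip dotNr raddfN. Qed.
Lemma ipBl x y z : ip (x - y) z = ip x z - ip y z.
Proof. by rewrite ipDl ipNl. Qed.
Lemma ipBr x y z : ip z (x - y) = ip z x - ip z y.
Proof. by rewrite ipDr ipNr. Qed.
Lemma ipC x y : ip x y = ip y x.
Proof. by rewrite /ip dotC; case: (dot y x). Qed.
Lemma ip0l x : ip 0 x = 0. Proof. by rewrite /ip dot0l. Qed.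
Lemma ip0r x : ip x 0 = 0. Proof. by rewrite /ip dot0r. Qed.

Lemma ip_nrm x : ip x x = nrm x ^+ 2.
Proof. by rewrite /ip -hH nrmE -rmorphXn. Qed.

Lemma nrm_sqD x y : nrm (x + y) ^+ 2 = nrm x ^+ 2 + 2 * ip x y + nrm y ^+ 2.
Proof. rewrite -!ip_nrm !ipDl !ipDr (ipC y x); lra. Qed.

Lemma nrm_sqB x y : nrm (x - y) ^+ 2 = nrm x ^+ 2 - 2 * ip x y + nrm y ^+ 2.
Proof. by rewrite nrm_sqD nrmN ipNr; lra. Qed.

Lemma parallelogram x y :
  nrm (x + y) ^+ 2 + nrm (x - y) ^+ 2 = 2 * (nrm x ^+ 2 + nrm y ^+ 2).
Proof. by rewrite nrm_sqD nrm_sqB; lra. Qed.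

Lemma ip_real (t : R) x y : ip (t%:C%C *: x) y = t * ip x y.
Proof. by rewrite /ip dotZl; case: (dot x y) => a b /=; rewrite mul0r subr0. Qed.

(** Expand the square of the norm of [|y| x - |x| y]. *)
Lemma cauchy_schwarz_ip x y : ip x y <= nrm x * nrm y.
Proof.
have [->|x0] := eqVneq x 0; first by rewrite ip0l nrm0 mul0r.
have [->|y0] := eqVneq y 0; first by rewrite ip0r nrm0 mulr0.
have nx : 0 < nrm x by rewrite nrm_gt0.
have ny : 0 < nrm y by rewrite nrm_gt0.
have := sqr_ge0 (nrm ((nrm y)%:C%C *: x - (nrm x)%:C%C *: y)).
rewrite nrm_sqB ip_real (ipC x) ip_real (ipC y) !nrmZ !nrmC.
rewrite !ger0_norm ?nrm_ge0 //.
have -> : (nrm y * nrm x) ^+ 2 - 2 * (nrm y * (nrm x * ip x y)) +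
   (nrm x * nrm y) ^+ 2 = 2 * (nrm x * nrm y) * (nrm x * nrm y - ip x y) by ring.
by rewrite pmulr_rge0 ?subr_ge0 // mulr_gt0 // mulr_gt0.
Qed.

(** Rotating [x] by the phase of [dot x y] reduces to the real part. *)
Lemma cauchy_schwarz x y : nrm (dot x y) <= nrm x * nrm y.
Proof.
have [->|d0] := eqVneq (dot x y) 0; first by rewrite nrm0 mulr_ge0 ?nrm_ge0.
have := cauchy_schwarz_ip (((dot x y)^*)%C *: x) y.
have -> : ip ((dot x y)^*%C *: x) y = nrm (dot x y) * nrm (dot x y).
  by rewrite -expr2 nrm_sqr /ip dotZl; case: (dot x y) => a b /=; ring.
by rewrite nrmZ nrm_conj -mulrA ler_pM2l // nrm_gt0.
Qed.

Lemma cvg_ipl (T : Type) (F : set_system T) {FF : Filter F} (f : T -> H) l y :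
  f x @[x --> F] --> l -> ip (f x) y @[x --> F] --> ip l y.
Proof.
move=> /cvg_nrmP /cvgrPdist_lt fl; apply/cvgrPdist_lt => e e0.
have ny : 0 < nrm y + 1 by rewrite ltr_wpDl ?nrm_ge0.
near=> t.
rewrite -ipBl; apply: (@le_lt_trans _ _ (nrm (f t - l) * (nrm y + 1))).
  rewrite ler_norml.
  have h v : ip v y <= nrm v * (nrm y + 1).
    by rewrite (le_trans (cauchy_schwarz_ip _ _)) // ler_wpM2l ?nrm_ge0 // lerDl.
  by apply/andP; split; [rewrite lerNl -ipNl opprB|rewrite nrm_distC]; exact: h.
rewrite -ltr_pdivlMr //.
have -> : nrm (f t - l) = `|0 - nrm (f t - l)|.
  by rewrite sub0r normrN ger0_norm ?nrm_ge0.
by near: t; apply: fl; rewrite divr_gt0.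
Unshelve. all: by end_near. Qed.

Lemma cvg_ipr (T : Type) (F : set_system T) {FF : Filter F} (f : T -> H) l y :
  f x @[x --> F] --> l -> ip y (f x) @[x --> F] --> ip y l.
Proof.
move=> /(cvg_ipl (y := y)); rewrite (ipC l); under eq_fun do rewrite ipC.
exact.
Qed.

(** The real form determines the complex one; identities and limits are
    therefore proved for the former. *)
Lemma dot_ip x y : dot x y = (ip x y +i* - ip ('i%C *: x) y)%C.
Proof.
rewrite /ip dotZl; case: (dot x y) => a b /=.
by rewrite mul0r mul1r sub0r opprK.
Qed.

Lemma dot0_ip x y : (forall c : R[i], ip (c *: x) y = 0) -> dot x y = 0.
Proof. by move=> h; rewrite dot_ip h -[x]scale1r h oppr0. Qed.

Lemma dot_lim0 (u : nat -> H) l x : (forall n, dot x (u n) = 0) ->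
  u n @[n --> \oo] --> l -> dot x l = 0.
Proof.
move=> hu ul; apply: dot0_ip => c; 
have h : ip (c *: x) (u n) @[n --> \oo] --> ip (c *: x) l by exact: cvg_ipr.
have h0 : ip (c *: x) (u n) @[n --> \oo] --> (0 : R).
  apply: cvg_near_cst; near=> n; by rewrite /ip dotZl hu mulr0.
by rewrite -(cvg_lim _ h) // (cvg_lim _ h0).
Unshelve. all: by end_near. Qed.

End InnerProduct.

(** * Closed subspaces, projections and adjoints *)

Section Subspaces.
Context {R : realType} {H : completeNormedModType R[i]}.
Implicit Types (M : set H) (x y : H).

Section Closed.
Context {M : set H}.
Hypothesis cM : closed_subspace M.

Lemma subs0 : M 0.
Proof. by case: cM => -[+ _] _; rewrite inE. Qed.
Lemma subsZD a x y : M x -> M y -> M (a *: x + y).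
Proof.
by case: cM => -[_ +] _; move=> /(_ a x y); rewrite !inE => h ? ?; apply: h.
Qed.
Lemma subsZ a x : M x -> M (a *: x).
Proof. by move=> Mx; rewrite -[_ *: _]addr0; apply: subsZD => //; exact: subs0. Qed.
Lemma subsD x y : M x -> M y -> M (x + y).
Proof. by move=> Mx; rewrite -[x]scale1r; exact: subsZD. Qed.
Lemma subsN x : M x -> M (- x).
Proof. by rewrite -scaleN1r; exact: subsZ. Qed.
Lemma subsB x y : M x -> M y -> M (x - y).
Proof. by move=> Mx My; apply: subsD => //; exact: subsN. Qed.

Lemma subs_lim (T : Type) (F : set_system T) {FF : ProperFilter F} (f : T -> H) l :
  (\forall x \near F, M (f x)) -> f x @[x --> F] --> l -> M l.
Proof. by case: cM => _ clM Mf fl; apply: (closed_cvg M clM Mf l fl). Qed.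

End Closed.

Lemma closed_subspace_intro M : M 0 -> (forall a x y, M x -> M y -> M (a *: x + y)) ->
  closed M -> closed_subspace M.
Proof.
move=> M0 MD cM; split=> //; split; first by rewrite inE.
by move=> a x y; rewrite !inE; exact: MD.
Qed.

Lemma closed_seqP M : (forall (u : nat -> H) l, (forall n, M (u n)) ->
  u n @[n --> \oo] --> l -> M l) -> closed M.
Proof.
move=> hM x clx.
have hu n : exists y, M y /\ nrm (y - x) < n.+1%:R^-1.
  have := clx (ball x (n.+1%:R^-1 : R)%:C%C).
  case; first by apply: nbhsx_ballx; rewrite ltcR.
  move=> y [My]; rewrite -ball_normE /= nrmE ltcR nrm_distC => ?; by exists y.
have [u hu'] := choice hu.
apply: (hM u) => [n|]; first by case: (hu' n).
apply/cvg_nrmP; apply: (squeeze_cvgr _ (cvg_cst 0) (@cvg_harmonic R)).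
near=> n; rewrite nrm_ge0 /=; exact/ltW/(hu' n).2.
Unshelve. all: by end_near. Qed.

End Subspaces.

Section Projection.
Context {R : realType} {H : completeNormedModType R[i]}.
Variable dot : {dot H for Num.conj}.
Hypothesis hH : hilbert dot.
Implicit Types (M : set H) (x y : H).

Lemma orthocomp_closed M : closed_subspace (orthocomp dot M).
Proof.
apply: closed_subspace_intro.
- by move=> x _; rewrite dot0r.
- by move=> a x y hx hy z Mz; rewrite dotDr dotZr hx // hy // mulr0 addr0.
- apply: closed_seqP => u l hu ul z Mz.
  by apply: (dot_lim0 hH _ ul) => n; exact: hu.
Qed.

(** A sequence in [M] that minimizes the distance to [x] is Cauchy by the
    parallelogram identity, and minimality of its limit forces orthogonality. *)
Lemma projection M x : closed_subspace M -> exists p, M p /\ orthocomp dot M (x - p).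
Proof.
move=> cM.
pose A := [set r | exists2 m, M m & r = nrm (x - m) ^+ 2].
have hiA : has_inf A.
  split; first by exists (nrm (x - 0) ^+ 2); exists 0 => //; exact: subs0.
  by exists 0 => r [m _ ->]; exact: sqr_ge0.
pose d := inf A.
have dle m : M m -> d <= nrm (x - m) ^+ 2.
  by move=> Mm; apply: ge_inf; [exact: hiA.2 | exists m].
have hu n : exists m, M m /\ nrm (x - m) ^+ 2 < d + n.+1%:R^-1.
  have [r [m Mm ->] h] := @inf_adherent _ A _ (ltac:(by []) : 0 < (n.+1%:R : R)^-1) hiA.
  by exists m.
have [u hu'] := choice hu.
have par n k : nrm (u n - u k) ^+ 2 <= 2 * (n.+1%:R^-1 + k.+1%:R^-1).
  have := parallelogram hH (x - u n) (x - u k).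
  have -> : x - u n - (x - u k) = - (u n - u k).
    by rewrite [RHS]opprB [in LHS]opprB addrC addrA subrK.
  have -> : x - u n + (x - u k) = (2 : R)%:C%C *: (x - (2^-1 : R)%:C%C *: (u n + u k)).
    rewrite scalerBr scalerA -rmorphM /= mulfV // scale1r addrACA -opprD.
    by rewrite (rmorph_nat (real_complex R) 2) scaler_nat mulr2n.
  rewrite nrmZ nrmC nrmN (ger0_norm (ler0n _ 2)) exprMn.
  have := dle _ (subsZ cM (2^-1 : R)%:C%C (subsD cM (hu' n).1 (hu' k).1)).
  have := (hu' n).2; have := (hu' k).2; set a := nrm _; set b := nrm _; set c := nrm _.
  rewrite (_ : 2 ^+ 2 = 4 :> R); last by rewrite -natrX.
  move: (a ^+ 2) (b ^+ 2) (c ^+ 2) (nrm _ ^+ 2) (n.+1%:R^-1) (k.+1%:R^-1) => A1 A2 A3 A4 A5 A6; clearbody d; lra.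
have [l ul] : exists l : H, u n @[n --> \oo] --> l.
  apply: nrm_cauchy_cvg => e e0.
  have [N hN] : exists N : nat, 4 / e ^+ 2 < N%:R.
    by exists (Num.trunc (4 / e ^+ 2)).+1; exact: truncnS_gt.
  exists N => n m Nn Nm; rewrite -ltr_sqr ?nnegrE ?nrm_ge0 ?(ltW e0) //.
  apply: le_lt_trans (par n m) _.
  have hb k : (N <= k)%N -> (k.+1%:R : R)^-1 < e ^+ 2 / 4.
    move=> Nk; rewrite invf_plt ?posrE ?divr_gt0 ?exprn_gt0 // invf_div.
    by apply: lt_le_trans hN _; rewrite ler_nat ltnW.
  have := hb _ Nn; have := hb _ Nm.
  by move: (n.+1%:R^-1) (m.+1%:R^-1) => a b; lra.
exists l; have Ml : M l.
  by apply: (subs_lim cM _ ul); near=> n; exact: (hu' n).1.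
split=> // m Mm.
have xl : nrm (x - l) ^+ 2 <= d.
  have h1 : nrm (x - u n) ^+ 2 @[n --> \oo] --> nrm (x - l) ^+ 2.
    have h : nrm (x - u n) @[n --> \oo] --> nrm (x - l).
      by apply: cvg_nrm; apply: cvgB => //; exact: cvg_cst.
    exact: (cvgM h h).
  have h2 : d + n.+1%:R^-1 @[n --> \oo] --> d.
    by rewrite -[X in _ --> X]addr0; apply: cvgD; [exact: cvg_cst|exact: cvg_harmonic].
  by apply: (ler_cvg_to h1 h2); near=> n; exact/ltW/(hu' n).2.
have ip0 y : M y -> ip dot y (x - l) = 0.
  move=> My.
  have [->|y0] := eqVneq y 0; first by rewrite ip0l.
  have ny : 0 < nrm y ^+ 2 by rewrite exprn_gt0 // nrm_gt0.
  set a := ip _ _ _; pose t := a / nrm y ^+ 2.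
  have := dle _ (subsD cM Ml (subsZ cM t%:C%C My)).
  rewrite opprD addrA (nrm_sqB hH) nrmZ nrmC exprMn real_normK ?num_real //.
  rewrite ipC ip_real -/a.
  have -> : t ^+ 2 * nrm y ^+ 2 = t * a by rewrite expr2 -mulrA /t divfK // gt_eqF.
  move=> hd; have : t * a <= 0 by lra.
  rewrite /t mulrAC -expr2 => h; apply/eqP; rewrite -sqrf_eq0.
  by rewrite eq_le sqr_ge0 andbT -(pmulr_lle0 _ (_ : 0 < (nrm y ^+ 2)^-1)) // invr_gt0.
have h1 := ip0 _ Mm.
have h2 := ip0 _ (subsZ cM 'i%C Mm).
move: h1 h2; rewrite /ip dotZl; case: (dot _ _) => a b /= ->.
by rewrite mul0r mul1r sub0r => /eqP; rewrite oppr_eq0 => /eqP ->.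
Unshelve. all: by end_near. Qed.

(** The double orthogonal complement of a closed subspace is the subspace; this
    is how membership in [M] is established below. *)
Lemma bicomplement M x : closed_subspace M ->
  (forall y, orthocomp dot M y -> dot y x = 0) -> M x.
Proof.
move=> cM hx; have [p [Mp op]] := projection x cM.
suff -> : x = p by [].
apply/eqP; rewrite -subr_eq0 -nrm_eq0 -sqrf_eq0 -(ip_nrm hH) /ip dotBr.
by rewrite (hx _ op) (dot_eq0C (op _ Mp)) subr0.
Qed.

Lemma nontrivial_orthocomp M : closed_subspace M -> M <> [set: H] ->
  exists y, orthocomp dot M y /\ y != 0.
Proof.
move=> cM; apply: contra_notP => h; apply/seteqP; split=> // x _.
apply: bicomplement => // y oy; have [->|y0] := eqVneq y 0; first by rewrite dot0l.
by exfalso; apply: h; exists y.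
Qed.

(** A bounded functional vanishes off the line orthogonal to its kernel, and on
    that line it is a multiple of the inner product with a generator. *)
Lemma riesz (f : H -> R[i]) (C : R) :
  (forall a x y, f (a *: x + y) = a * f x + f y) ->
  (forall x, nrm (f x) <= C * nrm x) ->
  exists y, forall x, f x = dot x y.
Proof.
move=> lf bf.
have f0 : f 0 = 0.
  by apply/eqP; rewrite -nrm_eq0 eq_le nrm_ge0 andbT (le_trans (bf 0)) // nrm0 mulr0.
have fB x y : f (x - y) = f x - f y.
  by rewrite addrC -scaleN1r lf mulN1r addrC.
have fZ a x : f (a *: x) = a * f x by rewrite -[a *: x]addr0 lf f0 addr0.
pose M := [set x | f x = 0].
have cM : closed_subspace M.
  apply: closed_subspace_intro => //.
    by move=> a x y; rewrite /M /= lf => hx hy; rewrite hx hy mulr0 addr0.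
  apply: closed_seqP => u l hu ul /=.
  apply/eqP; rewrite -nrm_eq0 eq_le nrm_ge0 andbT.
  have h : C * nrm (u n - l) @[n --> \oo] --> (0 : R).
    rewrite -[X in _ --> X](mulr0 C); apply: cvgMl_tmp.
    by move/cvg_nrmP : ul.
  apply: (ler_cvg_to (cvg_cst (nrm (f l))) h); near=> n.
  apply: le_trans (bf _); by rewrite fB hu sub0r nrmN.
have [MT|/eqP MT] := pselect (M = [set: H]).
  exists 0 => x; rewrite dot0r; by have : [set: H] x by []; rewrite -MT.
have [e [oe e0]] := nontrivial_orthocomp cM (elimN eqP MT).
have ee0 : dot e e != 0 by rewrite -hH sqrf_eq0 normr_eq0.
exists ((f e / dot e e)^*%C *: e) => x.
have : M (f x *: e - f e *: x).
  by rewrite /M /= fB !fZ mulrC subrr.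
move=> /oe; rewrite dotBl !dotZl dotZr conjcK => /eqP; rewrite subr_eq0 => /eqP h.
by rewrite mulrAC -h mulfK.
Unshelve. all: by end_near. Qed.

(** Riesz representation provides a witness for the choice that defines the
    adjoint. *)
Lemma adjoint_exists (A : H -> H) : linear A -> (forall x, nrm (A x) <= nrm x) ->
  forall x y, dot (A x) y = dot x (adjoint dot A y).
Proof.
move=> lA bA; rewrite /adjoint.
have [|B hB] := @choice _ _ (fun y z => forall x, dot (A x) y = dot x z).
  move=> y; apply: (@riesz (fun x => dot (A x) y) (nrm y)).
    by move=> a u v; rewrite lA dotDl dotZl.
  move=> x; apply: le_trans (cauchy_schwarz hH _ _) _.
  by rewrite mulrC ler_wpM2l ?nrm_ge0.
suff : [set B : H -> H | forall x y, dot (A x) y = dot x (B y)] (adjoint dot A) by [].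
by apply: (@xgetPex _ (fun=> 0)); exists B => x y; exact: hB.
Qed.

Lemma dot_inj x y : (forall z, dot z x = dot z y) -> x = y.
Proof.
move=> h; apply/eqP; rewrite -subr_eq0 -nrm_eq0 -sqrf_eq0 -(ip_nrm hH) /ip dotBr.
by rewrite h subrr.
Qed.

End Projection.

(** * Square roots of positive operators *)

Section BoundedOps.
Context {R : realType} {H : completeNormedModType R[i]}.
Implicit Types (A B X : H -> H) (x y : H).

Definition bounded_by (C : R) A := forall x, nrm (A x) <= C * nrm x.

Section Linear.
Context {A : H -> H}.
Hypothesis lA : linear A.
Lemma lin0 : A 0 = 0.
Proof.
have := lA 1 0 0; rewrite scaler0 addr0 scale1r => /eqP.
by rewrite -subr_eq0 opprD addrA subrr sub0r oppr_eq0 => /eqP.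
Qed.
Lemma linZ a x : A (a *: x) = a *: A x.
Proof. by rewrite -[a *: x]addr0 lA lin0 addr0. Qed.
Lemma linD x y : A (x + y) = A x + A y.
Proof. by rewrite -[x]scale1r lA !scale1r. Qed.
Lemma linN x : A (- x) = - A x.
Proof. by rewrite -scaleN1r linZ scaleN1r. Qed.
Lemma linB x y : A (x - y) = A x - A y.
Proof. by rewrite linD linN. Qed.
Lemma lin_sum n (u : nat -> H) :
  A (\sum_(k < n) u k) = \sum_(k < n) A (u k).
Proof.
by elim: n => [|n ih]; rewrite ?big_ord0 ?lin0 // !big_ord_recr /= linD ih.
Qed.
End Linear.

Lemma cvg_op A C (T : Type) (F : set_system T) {FF : Filter F} (f : T -> H) l :
  linear A -> bounded_by C A -> f x @[x --> F] --> l -> A (f x) @[x --> F] --> A l.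
Proof.
move=> lA bA /cvg_nrmP fl; apply/cvg_nrmP.
have h : C * nrm (f x - l) @[x --> F] --> (0 : R).
  by rewrite -[X in _ --> X](mulr0 C); exact: cvgMl_tmp.
apply: squeeze_cvgr h; last exact: cvg_cst.
by near=> t; rewrite nrm_ge0 -(linB lA) bA.
Unshelve. all: by end_near. Qed.

Lemma bounded_continuous A C : linear A -> bounded_by C A -> continuous A.
Proof. by move=> lA bA x; apply: (cvg_op lA bA). Qed.

End BoundedOps.

Section SquareRoot.
Context {R : realType} {H : completeNormedModType R[i]}.
Variable dot : {dot H for Num.conj}.
Hypothesis hH : hilbert dot.
Implicit Types (A B X Z : H -> H) (x y : H).

Definition selfadjoint A := forall x y, dot (A x) y = dot x (A y).

Definition half : R[i] := (2^-1 : R)%:C%C.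

(** If [Y = (Z + Y^2) / 2] then [(I - Y)^2 = I - Z].  The iteration starts from
    [0], and each iterate is a polynomial in [Z]. *)
Fixpoint sqrt_iter Z n : H -> H := match n with
  | 0 => fun=> 0
  | m.+1 => fun x => half *: (Z x + sqrt_iter Z m (sqrt_iter Z m x)) end.

(** The same iteration for the scalar [Z = 1]: its increments dominate those of
    the operator iteration, since every coefficient involved is nonnegative. *)
Fixpoint sqrt_bound n : R := match n with
  | 0 => 0
  | m.+1 => 2^-1 * (1 + sqrt_bound m ^+ 2) end.

Lemma sqrt_bound_itv n : 0 <= sqrt_bound n <= 1.
Proof.
elim: n => [|n /andP[h0 h1]] /=; first by rewrite lexx ler01.
by have := sqr_ge0 (sqrt_bound n); nra.
Qed.

Lemma sqrt_boundS n : sqrt_bound n <= sqrt_bound n.+1.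
Proof. by rewrite /=; have := sqr_ge0 (1 - sqrt_bound n); nra. Qed.

Lemma nrm_half x : nrm (half *: x) = 2^-1 * nrm x.
Proof. by rewrite nrmZ nrmC ger0_norm. Qed.

(** The iterates are polynomials in [Z], so an intertwining relation passes to
    them; this is what later carries it to the square roots. *)
Lemma sqrt_iter_comm X C Z Z' n x : linear X -> bounded_by C X ->
  (forall y, X (Z y) = Z' (X y)) -> X (sqrt_iter Z n x) = sqrt_iter Z' n (X x).
Proof.
move=> lX bX h; elim: n x => [|n ih] x /=; first exact: lin0.
by rewrite (linZ lX) (linD lX) h !ih.
Qed.

Section Fixed.
Variable Z : H -> H.
Hypotheses (lZ : linear Z) (bZ : bounded_by 1 Z) (sZ : selfadjoint Z).

Lemma sqrt_iter_linear n : linear (sqrt_iter Z n).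
Proof.
elim: n => [|n ih] a x y /=; first by rewrite scaler0 addr0.
by rewrite lZ ih ih !scalerDr !scalerA [half * a]mulrC addrACA.
Qed.

Lemma sqrt_iter_bounded n : bounded_by (sqrt_bound n) (sqrt_iter Z n).
Proof.
elim: n => [|n ih] x /=; first by rewrite nrm0 mul0r.
rewrite nrm_half -mulrA ler_pM2l ?invr_gt0 // mulrDl.
apply: le_trans (nrmD _ _) _; apply: lerD; first exact: bZ.
apply: le_trans (ih _) _; rewrite expr2 -mulrA ler_wpM2l //.
by case/andP: (sqrt_bound_itv n).
Qed.

Lemma sqrt_iter_contr n : bounded_by 1 (sqrt_iter Z n).
Proof.
move=> x; apply: le_trans (sqrt_iter_bounded n x) _.
by rewrite ler_wpM2r ?nrm_ge0 //; case/andP: (sqrt_bound_itv n).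
Qed.

(** A difference of squares [A A - B B] is [A (A - B) + (A - B) B], and each
    factor is bounded by its scalar counterpart. *)
Lemma sqrt_iter_step n :
  bounded_by (sqrt_bound n.+1 - sqrt_bound n)
    (fun x => sqrt_iter Z n.+1 x - sqrt_iter Z n x).
Proof.
elim: n => [|n ih] x.
  rewrite /= subr0 addr0 nrm_half expr0n /= addr0 mulr1 subr0 ler_pM2l ?invr_gt0 //.
  by have := bZ x; rewrite mul1r.
have -> : sqrt_iter Z n.+2 x - sqrt_iter Z n.+1 x =
  half *: (sqrt_iter Z n.+1 (sqrt_iter Z n.+1 x - sqrt_iter Z n x) +
    (sqrt_iter Z n.+1 (sqrt_iter Z n x) - sqrt_iter Z n (sqrt_iter Z n x))).
  rewrite (linB (sqrt_iter_linear _)) addrA subrK.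
  by rewrite [LHS]/= -scalerBr opprD addrACA subrr add0r.
rewrite nrm_half.
have -> : sqrt_bound n.+2 - sqrt_bound n.+1 = 2^-1 * (sqrt_bound n.+1 *
  (sqrt_bound n.+1 - sqrt_bound n) +
  (sqrt_bound n.+1 - sqrt_bound n) * sqrt_bound n).
  transitivity (2^-1 * (1 + sqrt_bound n.+1 ^+ 2) -
    2^-1 * (1 + sqrt_bound n ^+ 2)); first by [].
  by move: (sqrt_bound n.+1) (sqrt_bound n) => a b; ring.
rewrite -mulrA ler_pM2l ?invr_gt0 //; apply: le_trans (nrmD _ _) _.
rewrite mulrDl; apply: lerD.
  apply: le_trans (sqrt_iter_bounded _ _) _; rewrite -mulrA ler_wpM2l //.
  by case/andP: (sqrt_bound_itv n.+1).
apply: le_trans (ih _) _; rewrite -mulrA ler_wpM2l ?subr_ge0 ?sqrt_boundS //.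
exact: sqrt_iter_bounded.
Qed.

Lemma sqrt_iter_diff n k x : nrm (sqrt_iter Z (n + k) x - sqrt_iter Z n x) <=
  (sqrt_bound (n + k) - sqrt_bound n) * nrm x.
Proof.
elim: k => [|k ih]; first by rewrite addn0 !subrr nrm0 mul0r.
rewrite addnS; apply: le_trans (nrm_tri _ (sqrt_iter Z (n + k) x) _) _.
by have := sqrt_iter_step (n + k) x; move: ih; lra.
Qed.

(** The scalar sequence is increasing and bounded by [1], so the increments are
    summable. *)
Lemma sqrt_iter_cvg x : exists l : H, sqrt_iter Z n x @[n --> \oo] --> l.
Proof.
have nd : nondecreasing_seq sqrt_bound.
  by apply/nondecreasing_seqP => n; exact: sqrt_boundS.
have ub : has_ubound (range sqrt_bound).
  by exists 1 => _ [n _ <-]; case/andP: (sqrt_bound_itv n).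
have cv := nondecreasing_is_cvgn nd ub.
have nx : 0 < nrm x + 1 by rewrite ltr_wpDl ?nrm_ge0.
apply: nrm_cauchy_cvg => e e0.
have e0' : 0 < e / (nrm x + 1) / 2 by rewrite !divr_gt0.
have [N _ hN] := (cvgrPdist_lt _ _).1 cv _ e0'.
have le_l n : sqrt_bound n <= limn sqrt_bound := nondecreasing_cvgn_le nd cv n.
have key n : (N <= n)%N -> nrm (sqrt_iter Z n x - sqrt_iter Z N x) < e / 2.
  move=> Nn; rewrite -(subnKC Nn); apply: le_lt_trans (sqrt_iter_diff _ _ _) _.
  apply: (@le_lt_trans _ _ ((limn sqrt_bound - sqrt_bound N) * (nrm x + 1))).
    apply: ler_pM; rewrite ?nrm_ge0 ?lerD2r ?le_l ?lerDl // subr_ge0 nd //.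
    exact: leq_addr.
  rewrite -ltr_pdivlMr // mulrAC; have := hN N (leqnn N).
  by rewrite ger0_norm ?subr_ge0.
exists N => n m Nn Nm; apply: le_lt_trans (nrm_tri _ (sqrt_iter Z N x) _) _.
by rewrite (nrm_distC _ (sqrt_iter Z m x)); have := key _ Nn; have := key _ Nm; lra.
Qed.
End Fixed.

Definition sqrt_lim Z x : H := lim (sqrt_iter Z n x @[n --> \oo]).

(** The positive square root of [I - Z]. *)
Definition compl_root Z x : H := x - sqrt_lim Z x.

Section Limit.
Variable Z : H -> H.
Hypotheses (lZ : linear Z) (bZ : bounded_by 1 Z) (sZ : selfadjoint Z).

Lemma sqrt_lim_cvg x : sqrt_iter Z n x @[n --> \oo] --> sqrt_lim Z x.
Proof. by have [l hl] := sqrt_iter_cvg lZ bZ x; rewrite /sqrt_lim (cvg_lim _ hl). Qed.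

Lemma cvgH_unique (u : nat -> H) (l l' : H) :
  u n @[n --> \oo] --> l -> u n @[n --> \oo] --> l' -> l = l'.
Proof. by move=> h h'; rewrite -(cvg_lim _ h) // (cvg_lim _ h'). Qed.

Lemma sqrt_lim_linear : linear (sqrt_lim Z).
Proof.
move=> a x y; apply: (cvgH_unique (@sqrt_lim_cvg (a *: x + y))).
rewrite (_ : (fun n => _) = fun n => a *: sqrt_iter Z n x + sqrt_iter Z n y).
  by apply: cvgD; [apply: cvgZl_tmp|]; exact: sqrt_lim_cvg.
by apply/funext => n; rewrite sqrt_iter_linear.
Qed.

Lemma sqrt_lim_bounded : bounded_by 1 (sqrt_lim Z).
Proof.
move=> x; apply: (ler_cvg_to (cvg_nrm (@sqrt_lim_cvg x)) (cvg_cst (1 * nrm x))).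
by near=> n; exact: sqrt_iter_contr.
Unshelve. all: by end_near. Qed.

Lemma sqrt_iter_selfadjoint n : selfadjoint (sqrt_iter Z n).
Proof.
elim: n => [|n ih] x y /=; first by rewrite dot0l dot0r.
rewrite dotZl dotZr dotDl dotDr sZ !ih; congr (_ * _).
by rewrite /half conjc_real.
Qed.

Lemma ip_selfadjoint A : selfadjoint A -> forall x y, ip dot (A x) y = ip dot x (A y).
Proof. by move=> h x y; rewrite /ip h. Qed.

Lemma sqrt_lim_selfadjoint : selfadjoint (sqrt_lim Z).
Proof.
move=> x y.
have key u v : ip dot (sqrt_lim Z u) v = ip dot u (sqrt_lim Z v).
  have h1 : ip dot (sqrt_iter Z n u) v @[n --> \oo] --> ip dot (sqrt_lim Z u) v.
    by apply: (cvg_ipl hH); exact: sqrt_lim_cvg.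
  have h2 : ip dot u (sqrt_iter Z n v) @[n --> \oo] --> ip dot u (sqrt_lim Z v).
    by apply: (cvg_ipr hH); exact: sqrt_lim_cvg.
  rewrite -(cvg_lim _ h1) // -(cvg_lim _ h2) //; congr (lim _).
  by under eq_fun do rewrite (ip_selfadjoint (sqrt_iter_selfadjoint _)).
by rewrite !dot_ip -(linZ sqrt_lim_linear) !key.
Qed.

(** Pass to the limit in the recursion; the iterates are uniformly bounded, so
    the composition [Y_n Y_n] converges strongly as well. *)
Lemma sqrt_lim_eq x : sqrt_lim Z x = half *: (Z x + sqrt_lim Z (sqrt_lim Z x)).
Proof.
have h1 : sqrt_iter Z n.+1 x @[n --> \oo] --> sqrt_lim Z x.
  by have := @sqrt_lim_cvg x; rewrite -(cvg_shiftS (fun n => sqrt_iter Z n x)).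
apply: (cvgH_unique h1) => /=; apply: cvgZl_tmp; apply: cvgD; first exact: cvg_cst.
set l := sqrt_lim Z x.
have h2 : sqrt_iter Z n (sqrt_iter Z n x - l) @[n --> \oo] --> (0 : H).
  have h3 : nrm (sqrt_iter Z n x - l) @[n --> \oo] --> (0 : R).
    by apply/cvg_nrmP; exact: sqrt_lim_cvg.
  apply/cvg_nrmP; apply: squeeze_cvgr h3; last exact: cvg_cst.
  near=> n; rewrite nrm_ge0 /= subr0.
  by have := sqrt_iter_contr bZ n (sqrt_iter Z n x - l); rewrite mul1r.
rewrite -[sqrt_lim Z l]add0r.
rewrite (_ : (fun n => _) = fun n => sqrt_iter Z n (sqrt_iter Z n x - l) +
   sqrt_iter Z n l).
  by apply: cvgD => //; exact: sqrt_lim_cvg.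
by apply/funext => n; rewrite (linB (sqrt_iter_linear lZ n)) subrK.
Unshelve. all: by end_near. Qed.

Lemma compl_root_linear : linear (compl_root Z).
Proof.
by move=> a x y; rewrite /compl_root sqrt_lim_linear opprD addrACA -scalerBr.
Qed.

Lemma compl_root_bounded : bounded_by 2 (compl_root Z).
Proof.
move=> x; rewrite /compl_root; apply: le_trans (nrmD _ _) _.
by rewrite nrmN; have := sqrt_lim_bounded x; lra.
Qed.

Lemma compl_root_selfadjoint : selfadjoint (compl_root Z).
Proof. by move=> x y; rewrite dotBl dotBr sqrt_lim_selfadjoint. Qed.

Lemma compl_root_sqr x : compl_root Z (compl_root Z x) = x - Z x.
Proof.
rewrite /compl_root (linB sqrt_lim_linear); have := sqrt_lim_eq x.
move: (sqrt_lim Z (sqrt_lim Z x)) => w; move: (sqrt_lim Z x) => v h.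
have h2 : v + v = Z x + w.
  rewrite {1 2}h -scalerDl -rmorphD /= (_ : 2^-1 + 2^-1 = 1 :> R) ?scale1r //; lra.
have -> : Z x = v + v - w by rewrite h2 addrK.
by rewrite !opprB opprD -addrA [- v + _]addrCA.
Qed.

Lemma ip_compl_root_ge0 x : 0 <= ip dot (compl_root Z x) x.
Proof.
rewrite /compl_root ipBl (ip_nrm hH) subr_ge0.
apply: le_trans (cauchy_schwarz_ip hH _ _) _.
by rewrite expr2 ler_wpM2r ?nrm_ge0 //; have := sqrt_lim_bounded x; rewrite mul1r.
Qed.

Lemma compl_root_positive : positive_op dot (compl_root Z).
Proof.
split.
  split; first exact: compl_root_linear.
  exact: bounded_continuous compl_root_linear compl_root_bounded.
move=> x; rewrite lecE /=; apply/andP; split; last exact: ip_compl_root_ge0.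
have := dotC dot (compl_root Z x) x; rewrite -compl_root_selfadjoint.
by case: (dot _ _) => a b /= [/eqP]; rewrite -subr_eq0 opprK -mulr2n mulrn_eq0.
Qed.

End Limit.

Lemma compl_root_comm X C Z Z' x : linear X -> bounded_by C X ->
  linear Z -> bounded_by 1 Z -> linear Z' -> bounded_by 1 Z' ->
  (forall y, X (Z y) = Z' (X y)) -> X (compl_root Z x) = compl_root Z' (X x).
Proof.
move=> lX bX lZ bZ lZ' bZ' h; rewrite /compl_root (linB lX); congr (_ - _).
have h1 : X (sqrt_iter Z n x) @[n --> \oo] --> X (sqrt_lim Z x).
  by apply: (cvg_op lX bX); exact: sqrt_lim_cvg.
apply: (cvgH_unique h1); have := sqrt_lim_cvg lZ' bZ' (x := X x).
rewrite (_ : (fun n => _) = fun n => X (sqrt_iter Z n x)) //.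
by apply/funext => n; rewrite (sqrt_iter_comm _ _ lX bX h).
Qed.

Lemma compl_root_stable Z M : linear Z -> bounded_by 1 Z -> closed_subspace M ->
  (forall x, M x -> M (Z x)) -> forall x, M x -> M (compl_root Z x).
Proof.
move=> lZ bZ cM hZ x Mx; apply: (subsB cM) => //.
have key n y : M y -> M (sqrt_iter Z n y).
  elim: n y => [|n ih] y My /=; first exact: subs0.
  by apply/(subsZ cM)/(subsD cM); [exact: hZ|exact/ih/ih].
by apply: (subs_lim cM _ (sqrt_lim_cvg lZ bZ (x := x))); near=> n; exact: key.
Unshelve. all: by end_near. Qed.

(** Over the complex numbers, polarization recovers a sesquilinear form from
    its diagonal. *)
Lemma positive_selfadjoint B : positive_op dot B -> selfadjoint B.
Proof.
move=> -[[lB _] pB].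
pose s x y := dot (B x) y - dot x (B y).
have s0 x : s x x = 0.
  rewrite /s (dotC dot x); have := pB x; rewrite lecE => /andP[/eqP /= h _].
  by case: (dot _ _) h => a b /= ->; rewrite oppr0 subrr.
have sD x y : s x y + s y x = 0.
  transitivity (s (x + y) (x + y) - s x x - s y y); last by rewrite !s0 !subr0.
  by rewrite /s (linD lB) !dotDl !dotDr; ring.
have sZ x y : s x ('i%C *: y) = - 'i%C * s x y.
  rewrite /s (linZ lB) !dotZr mulrBr; congr (_ * _ - _ * _);
  by apply/eqP; rewrite eq_complex /= !oppr0 !eqxx.
have sZ' x y : s ('i%C *: x) y = 'i%C * s x y.
  by rewrite /s (linZ lB) !dotZl mulrBr.
move=> x y; apply/eqP; rewrite -subr_eq0 -/(s x y).
have := sD x ('i%C *: y); rewrite sZ sZ' mulNr addrC -mulrBr => /eqP.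
rewrite mulf_eq0 => /orP[|].
  by rewrite eq_complex /= oner_eq0 andbF.
rewrite subr_eq0 => /eqP h; have := sD x y; rewrite h -mulr2n => /eqP.
by rewrite mulrn_eq0.
Qed.

(** The nonnegative quadratic polynomial [t |-> <B (y + t B y), y + t B y>]
    vanishes at [0], so its linear coefficient [2 |B y|^2] must vanish too. *)
Lemma positive_ker B y : positive_op dot B -> ip dot (B y) y = 0 -> B y = 0.
Proof.
move=> pB h; have sB := positive_selfadjoint pB; have [[lB _] pB'] := pB.
have pBr x : 0 <= ip dot (B x) x by have := pB' x; rewrite lecE => /andP[].
set w := B y; set a := nrm w ^+ 2; set b := ip dot (B w) w.
have a0 : 0 <= a by exact: sqr_ge0.
have b0 : 0 <= b by exact: pBr.
have key (t : R) : 0 <= 2 * t * a + t ^+ 2 * b.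
  have := pBr (y + t%:C%C *: w).
  rewrite (linD lB) (linZ lB) ipDl !ipDr h ip_real (ipC _ (B y)) !ip_real.
  rewrite (ipC _ (B w) (_ *: _)) ip_real (ip_selfadjoint sB w y) -/w (ip_nrm hH) -/a.
  rewrite (ipC _ w (B w)) -/b; move: a b {a0 b0} => a b; lra.
suff : a = 0 by move/eqP; rewrite sqrf_eq0 nrm_eq0 => /eqP.
have b1 : 0 < b + 1 by lra.
have := key (- a / (b + 1)).
have -> : 2 * (- a / (b + 1)) * a + (- a / (b + 1)) ^+ 2 * b =
  - (a ^+ 2 * (b + 2) / (b + 1) ^+ 2) by field; rewrite gt_eqF.
rewrite oppr_ge0 pmulr_lle0 ?invr_gt0 ?exprn_gt0 // pmulr_lle0; last by lra.
by move=> h1; apply/eqP; rewrite -sqrf_eq0 eq_le h1 sqr_ge0.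
Qed.

(** A root [B] commutes with [Z], hence with the root [C] that was constructed.
    Then [(B + C) (B - C) = 0], and positivity of both summands gives
    [B (B - C) = C (B - C) = 0], so [(B - C)^2 = 0]. *)
Lemma positive_root_unique Z B : linear Z -> bounded_by 1 Z -> selfadjoint Z ->
  positive_op dot B -> B \o B = (fun x => x - Z x) -> B = compl_root Z.
Proof.
move=> lZ bZ sZ pB hB; have sB := positive_selfadjoint pB; have [[lB _] _] := pB.
have BB x : B (B x) = x - Z x by have /= := congr1 (fun f => f x) hB.
have bB : bounded_by 2 B.
  move=> x; rewrite -ler_sqr ?nnegrE ?mulr_ge0 ?nrm_ge0 //.
  rewrite -(ip_nrm hH) -(ip_selfadjoint sB) BB ipBl (ip_nrm hH) exprMn.
  have := cauchy_schwarz_ip hH (- Z x) x; rewrite ipNl nrmN.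
  have := bZ x; have := nrm_ge0 x; set a := nrm _; nra.
have cB x : B (Z x) = Z (B x).
  have h := BB (B x); have := linB lB x (Z x); rewrite -BB h.
  by move/addrI/oppr_inj.
set C := compl_root Z.
have lC : linear C := compl_root_linear lZ bZ.
have pC := compl_root_positive lZ bZ sZ.
have BC x : B (C x) = C (B x) by apply: (compl_root_comm x lB bB).
apply/funext => x; set y := B x - C x.
have e : B y + C y = 0.
  by rewrite /y (linB lB) (linB lC) BC addrA subrK BB (compl_root_sqr lZ bZ x : C (C x) = _) subrr.
have h : ip dot (B y) y + ip dot (C y) y = 0 by rewrite -ipDl e ip0l.
have pos A : positive_op dot A -> 0 <= ip dot (A y) y.
  by case=> _ /(_ y); rewrite lecE => /andP[].
have /eqP := h; rewrite paddr_eq0 ?pos // => /andP[/eqP hb /eqP hc].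
have By := positive_ker pB hb; have Cy := positive_ker pC hc.
apply/eqP; rewrite -subr_eq0 -/y -nrm_eq0 -sqrf_eq0 -(ip_nrm hH) {1}/y ipBl.
rewrite (ip_selfadjoint sB) (ip_selfadjoint (compl_root_selfadjoint lZ bZ sZ)).
by rewrite By Cy ip0r subrr.
Qed.

Lemma sqrt_op_compl_root Z : linear Z -> bounded_by 1 Z -> selfadjoint Z ->
  sqrt_op dot (fun x => x - Z x) = compl_root Z.
Proof.
move=> lZ bZ sZ; rewrite /sqrt_op.
set P := (X in xget _ X).
have : P (xget (fun=> 0) P).
  apply: (@xgetPex _ (fun=> 0)); exists (compl_root Z); split.
    exact: compl_root_positive.
  by apply/funext => x /=; rewrite (compl_root_sqr lZ bZ).
by move=> [pB hB]; apply: positive_root_unique.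
Qed.

End SquareRoot.

(** * Defect operators and the characteristic function *)

Section Contractions.
Context {R : realType} {H : completeNormedModType R[i]}.
Variable dot : {dot H for Num.conj}.
Hypothesis hH : hilbert dot.
Implicit Types (x y u v : H) (z : R[i]).

(** Stating the hypotheses on the pair makes them symmetric in [T] and its
    adjoint, so that each result below applies to both. *)
Definition adjoint_contractions (T S : H -> H) : Prop :=
  [/\ linear T, bounded_by 1 T, linear S, bounded_by 1 S &
      forall x y, dot (T x) y = dot x (S y)].

Lemma adjoint_contractionsC T S :
  adjoint_contractions T S -> adjoint_contractions S T.
Proof. by move=> [? ? ? ? h]; split=> // x y; rewrite dotC -h -dotC. Qed.

Lemma contraction_adjoint T : Defs.contraction T ->
  adjoint_contractions T (adjoint dot T).
Proof.
move=> [lT cT]; have bT : bounded_by 1 T.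
  by move=> x; rewrite mul1r -lecR -!nrmE.
have aT : forall x y, dot (T x) y = dot x (adjoint dot T y).
  by apply: adjoint_exists => // x; have := bT x; rewrite mul1r.
split=> //.
- move=> a x y; apply: (dot_inj hH) => z.
  by rewrite -aT !dotDr !dotZr -!aT.
- move=> y; rewrite mul1r.
  set w := adjoint dot T y; have [->|w0] := eqVneq w 0; first by rewrite nrm0 nrm_ge0.
  have nw : 0 < nrm w by rewrite nrm_gt0.
  rewrite -(ler_pM2l nw) -expr2 -(ip_nrm hH) /ip {2}/w -aT.
  apply: le_trans (cauchy_schwarz_ip hH _ _) _.
  by rewrite ler_wpM2r ?nrm_ge0 //; have := bT w; rewrite mul1r.
Qed.

Lemma adjoint_unique T S : adjoint_contractions T S -> adjoint dot T = S.
Proof.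
move=> [lT bT lS bS aTS]; apply/funext => y; apply: (dot_inj hH) => z.
rewrite -aTS; symmetry; apply: adjoint_exists => // x.
by have := bT x; rewrite mul1r.
Qed.

Definition defect (T S : H -> H) : H -> H := compl_root (fun x => S (T x)).

Lemma defect_op_pair T S : adjoint_contractions T S -> defect_op dot T = defect T S.
Proof.
move=> h; rewrite /defect_op (adjoint_unique h); case: h => lT bT lS bS aTS.
apply: (sqrt_op_compl_root hH (Z := fun x => S (T x))).
- by move=> a x y; rewrite lT lS.
- by move=> x; have := bT x; have := bS (T x); lra.
- by move=> x y; rewrite -aTS [LHS]dotC -aTS -dotC.
Qed.

Section Pair.
Context {T S : H -> H}.
Hypothesis TS : adjoint_contractions T S.
Let lT : linear T. Proof. by case: TS. Qed.
Let lS : linear S. Proof. by case: TS. Qed.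
Let bT : bounded_by 1 T. Proof. by case: TS. Qed.
Let bS : bounded_by 1 S. Proof. by case: TS. Qed.
Let aT x y : dot (T x) y = dot x (S y). Proof. by case: TS. Qed.
Let aS x y : dot (S x) y = dot x (T y).
Proof. by rewrite dotC -aT -dotC. Qed.
Local Notation D := (defect T S).
Local Notation D' := (defect S T).

Let lST : linear (fun x => S (T x)). Proof. by move=> a x y; rewrite lT lS. Qed.
Let bST : bounded_by 1 (fun x => S (T x)).
Proof. by move=> x; have := bT x; have := bS (T x); lra. Qed.
Let lTS : linear (fun x => T (S x)). Proof. by move=> a x y; rewrite lS lT. Qed.
Let bTS : bounded_by 1 (fun x => T (S x)).
Proof. by move=> x; have := bS x; have := bT (S x); lra. Qed.
Let sST : selfadjoint dot (fun x => S (T x)).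
Proof. by move=> x y; rewrite aS aT. Qed.

Lemma defect_linear : linear D. Proof. exact: compl_root_linear. Qed.

Lemma defect_selfadjoint x y : dot (D x) y = dot x (D y).
Proof. exact: (compl_root_selfadjoint hH). Qed.

Lemma defect_sqr x : D (D x) = x - S (T x).
Proof. exact: (compl_root_sqr lST). Qed.

Lemma nrm_defect x : nrm (D x) ^+ 2 = nrm x ^+ 2 - nrm (T x) ^+ 2.
Proof.
rewrite -!(ip_nrm hH) /ip defect_selfadjoint defect_sqr dotBr -aT.
by rewrite raddfB.
Qed.

Lemma defect_bounded : bounded_by 1 D.
Proof.
move=> x; rewrite mul1r -ler_sqr ?nnegrE ?nrm_ge0 // nrm_defect.
by have := sqr_ge0 (nrm (T x)); lra.
Qed.

(** [T (I - S T) = (I - T S) T], and the relation passes to square roots. *)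
Lemma defect_intertwine x : T (D x) = D' (T x).
Proof. exact: (compl_root_comm x lT bT lST bST lTS bTS). Qed.

Lemma defect_stable M : closed_subspace M -> (forall x, M x -> M (T x)) ->
  (forall x, M x -> M (S x)) -> forall x, M x -> M (D x).
Proof.
move=> cM hT hS; apply: compl_root_stable => // x Mx; exact/hS/hT.
Qed.

(** The Neumann series. *)
Lemma resolvent_exists z x : nrm z < 1 -> exists u, u - z *: S u = x.
Proof.
move=> z1; pose s n := \sum_(k < n) z ^+ k *: iter k S x.
have lzS : linear (fun y => y - z *: S y).
  move=> a u v; rewrite lS !scalerDr !scalerN opprD addrACA !scalerA.
  by rewrite [z * a]mulrC.
have bz : bounded_by 2 (fun y => y - z *: S y).
  move=> y; apply: le_trans (nrmD _ _) _; rewrite nrmN nrmZ.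
  have := bS y; have := nrm_ge0 y; have := nrm_ge0 (S y); have := nrm_ge0 z.
  by move: z1; set a := nrm z; nra.
have iS n y : nrm (iter n S y) <= nrm y.
  elim: n => //= n ih; have := bS (iter n S y); rewrite mul1r.
  by move/le_trans; apply.
have tail n k : nrm (s (n + k)%N - s n) <= nrm z ^+ n / (1 - nrm z) * nrm x.
  have z1' : 0 < 1 - nrm z by rewrite subr_gt0.
  have -> : nrm z ^+ n / (1 - nrm z) * nrm x =
    (nrm z ^+ n - nrm z ^+ (n + k)) / (1 - nrm z) * nrm x +
    nrm z ^+ (n + k) / (1 - nrm z) * nrm x by field; rewrite gt_eqF.
  rewrite -[leLHS]addr0; apply: lerD; last first.
    by rewrite !mulr_ge0 ?exprn_ge0 ?nrm_ge0 // invr_ge0 ltW.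
  elim: k => [|k ih]; first by rewrite addn0 !subrr nrm0 !mul0r.
  rewrite addnS; apply: le_trans (nrm_tri _ (s (n + k)%N) _) _.
  rewrite {1}/s big_ord_recr /= -/(s _) addrAC subrr add0r nrmZ nrmX.
  have h1 : nrm z ^+ (n + k) * nrm (iter (n + k) S x) <= nrm z ^+ (n + k) * nrm x.
    by rewrite ler_wpM2l // exprn_ge0 // nrm_ge0.
  apply: le_trans (lerD h1 ih) _.
  rewrite exprS le_eqVlt; apply/orP; left; apply/eqP.
  by field; rewrite gt_eqF.
have z1' : 0 < 1 - nrm z by rewrite subr_gt0.
have nz : `|nrm z| < 1 by rewrite ger0_norm ?nrm_ge0.
have geo (C : R) : nrm z ^+ n * C @[n --> \oo] --> (0 : R).
  by rewrite -[X in _ --> X](mul0r C); apply: cvgMr_tmp; exact: cvg_expr.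
have geo' (C e : R) : 0 < e -> exists N, forall n, (N <= n)%N -> nrm z ^+ n * C < e.
  move=> e0; have [N _ hN] := (cvgrPdist_lt _ _).1 (geo C) e e0.
  exists N => n Nn; have := hN n Nn; rewrite sub0r normrN.
  exact/le_lt_trans/ler_norm.
have [u su] : exists u : H, s n @[n --> \oo] --> u.
  apply: nrm_cauchy_cvg => e e0.
  have [N hN] := geo' ((1 - nrm z)^-1 * nrm x) (e / 2) (divr_gt0 e0 (ltr0n _ 2)).
  have h n : (N <= n)%N -> nrm (s n - s N) < e / 2.
    move=> Nn; rewrite -(subnKC Nn); apply: le_lt_trans (tail _ _) _.
    by rewrite -mulrA; exact: hN.
  exists N => n m Nn Nm; apply: le_lt_trans (nrm_tri _ (s N) _) _.
  by rewrite (nrm_distC _ (s m)); have := h _ Nn; have := h _ Nm; lra.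
exists u.
have h1 : s n - z *: S (s n) @[n --> \oo] --> u - z *: S u.
  exact: (cvg_op lzS bz su).
have h2 : s n - z *: S (s n) @[n --> \oo] --> x.
  apply/cvg_nrmP; apply: (squeeze_cvgr _ (cvg_cst 0) (geo (nrm x))).
  near=> n; rewrite nrm_ge0 /=.
  have -> : s n - z *: S (s n) - x = - (z ^+ n *: iter n S x).
    elim: (n : nat) => [|m ih].
      by rewrite /s big_ord0 (lin0 lS) scaler0 subrr expr0 scale1r sub0r.
    rewrite /s !big_ord_recr /= -/(s m) (linD lS) (linZ lS) scalerDr scalerA -exprS.
    by rewrite opprD addrACA -[LHS]addrA [X in _ + X]addrC addrA ih addrA addNr add0r.
  by rewrite nrmN nrmZ nrmX ler_wpM2l // exprn_ge0 // nrm_ge0.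
by rewrite -(cvg_lim _ h1) // (cvg_lim _ h2).
Unshelve. all: by end_near. Qed.

End Pair.

Section CharFun.
Context {T S : H -> H}.
Hypothesis TS : adjoint_contractions T S.
Let ST : adjoint_contractions S T := adjoint_contractionsC TS.
Let lS : linear S. Proof. by case: TS. Qed.
Let bS : bounded_by 1 S. Proof. by case: TS. Qed.
Let aT x y : dot (T x) y = dot x (S y). Proof. by case: TS. Qed.
Local Notation D := (defect T S).
Local Notation D' := (defect S T).
Let lD' : linear D' := defect_linear ST.

Lemma char_funE z x : nrm z < 1 -> exists u, u - z *: S u = D x /\
  char_fun dot T z x = - T x + z *: D' u.
Proof.
move=> z1.
rewrite /char_fun (defect_op_pair TS) (adjoint_unique TS).
rewrite (defect_op_pair ST).
eexists; split; last reflexivity.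
set f := fun y => y - z *: S y.
have [u hu] := resolvent_exists TS (D x) z1.
by apply: (@pinvK _ _ (fun=> 0) setT f); rewrite inE; exists u.
Qed.

Lemma nrm_resolvent z x u : nrm z < 1 -> u - z *: S u = x ->
  nrm u <= nrm x / (1 - nrm z).
Proof.
move=> z1 <-; rewrite ler_pdivlMr ?subr_gt0 //.
have := nrmD (u - z *: S u) (z *: S u); rewrite subrK nrmZ.
have := bS u; have := nrm_ge0 (S u); have := nrm_ge0 z; nra.
Qed.

(** With [u] the resolvent at [D x], the relation [D' T = T D] turns the mixed
    term into one in [u] and [S u], and everything cancels except
    [(1 - |z|^2) |u|^2]. *)
Lemma char_fun_nrm z x u : u - z *: S u = D x ->
  nrm (- T x + z *: D' u) ^+ 2 = nrm x ^+ 2 - (1 - nrm z ^+ 2) * nrm u ^+ 2.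
Proof.
move=> hu.
rewrite addrC (nrm_sqB hH) -!(linZ lD').
have h1 : nrm (D' (z *: u)) ^+ 2 = nrm z ^+ 2 * (nrm u ^+ 2 - nrm (S u) ^+ 2).
  by rewrite (nrm_defect ST) (linZ lS) !nrmZ !exprMn mulrBr.
have h2 : ip dot (D' (z *: u)) (T x) = ip dot (z *: S u) (D x).
  by rewrite /ip (defect_selfadjoint ST) -(defect_intertwine TS) dotC aT -dotC (linZ lS).
have := nrm_defect TS x; rewrite h1 h2 -hu (ipBr _ u) (ip_nrm hH) (nrm_sqB hH).
rewrite (ipC _ (z *: S u) u) !nrmZ !exprMn.
move: (ip dot _ _) => p; lra.
Qed.

Lemma char_fun_contr z x : nrm z < 1 -> nrm (char_fun dot T z x) <= nrm x.
Proof.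
move=> z1; have [u [hu ->]] := char_funE x z1.
rewrite -ler_sqr ?nnegrE ?nrm_ge0 // (char_fun_nrm hu).
have : 0 <= (1 - nrm z ^+ 2) * nrm u ^+ 2; last by lra.
by rewrite mulr_ge0 ?sqr_ge0 // subr_ge0 exprn_ile1 ?nrm_ge0 // ltW.
Qed.

Definition char_coef x n : H := if n is m.+1 then D' (iter m S (D x)) else - T x.

Lemma iter_bounded n y : nrm (iter n S y) <= nrm y.
Proof.
elim: n => //= n ih; have := bS (iter n S y); rewrite mul1r.
by move/le_trans; apply.
Qed.

Lemma iter_linear n : linear (iter n S).
Proof. by elim: n => // n ih a x y /=; rewrite ih lS. Qed.

(** Iterating [u = D x + z S u] exhibits the remainder after [M] terms as
    [z^M] times a vector of norm at most [|u|]. *)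
Lemma char_fun_tail z x M : nrm z < 1 ->
  nrm (char_fun dot T z x - \sum_(k < M) z ^+ k *: char_coef x k) <=
  nrm x * (nrm z ^+ M / (1 - nrm z)).
Proof.
move=> z1; have z1' : 0 < 1 - nrm z by rewrite subr_gt0.
case: M => [|M].
  rewrite big_ord0 subr0; apply: le_trans (char_fun_contr x z1) _.
  rewrite ler_peMr ?nrm_ge0 // expr0 div1r invf_ge1 //.
  by have := nrm_ge0 z; lra.
have [u [hu ->]] := char_funE x z1.
have expand n : u = \sum_(k < n) z ^+ k *: iter k S (D x) + z ^+ n *: iter n S u.
  elim: n => [|n {1}->]; first by rewrite big_ord0 add0r scale1r.
  rewrite big_ord_recr /= -addrA; congr (_ + _).
  rewrite -{1}hu -iterS iterSr (linB (iter_linear n)) (linZ (iter_linear n)).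
  by rewrite scalerBr exprSr scalerA subrK.
have -> : \sum_(k < M.+1) z ^+ k *: char_coef x k =
    - T x + z *: D' (\sum_(k < M) z ^+ k *: iter k S (D x)).
  rewrite big_ord_recl expr0 scale1r.
  rewrite (lin_sum lD' M (fun k => z ^+ k *: iter k S (D x))) scaler_sumr.
  by congr (_ + _); apply: eq_bigr => k _; rewrite (linZ lD') scalerA -exprS.
rewrite {1}(expand M) (linD lD') scalerDr addrA [X in X - _]addrC addrK.
rewrite (linZ lD') scalerA -exprS nrmZ nrmX mulrA [nrm x * _]mulrC -mulrA.
rewrite ler_wpM2l ?exprn_ge0 ?nrm_ge0 //.
apply: (@le_trans _ _ (nrm u)).
  have := defect_bounded ST (iter M S u); rewrite mul1r; move/le_trans; apply.
  exact: iter_bounded.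
apply: le_trans (nrm_resolvent z1 hu) _; rewrite ler_wpM2r ?invr_ge0 ?(ltW z1') //.
by have := defect_bounded TS x; rewrite mul1r.
Qed.

(** [|D' v|^2 = |v|^2 - |S v|^2] makes the sum telescope. *)
Lemma char_coef_sum x M : \sum_(k < M.+1) nrm (char_coef x k) ^+ 2 =
  nrm x ^+ 2 - nrm (iter M S (D x)) ^+ 2.
Proof.
elim: M => [|M ih].
  by rewrite big_ord_recl big_ord0 addr0 /= nrmN (nrm_defect TS); ring.
by rewrite big_ord_recr ih /= (nrm_defect ST); ring.
Qed.

End CharFun.

(** Move [D'] and [D] across the inner product and compare the two resolvent
    equations. *)
Lemma char_fun_adjoint T S z x y : adjoint_contractions T S -> nrm z < 1 ->
  dot (char_fun dot T z x) y = dot x (char_fun dot S (z^*)%C y).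
Proof.
move=> TS z1; have ST := adjoint_contractionsC TS.
have [u [hu ->]] := char_funE TS x z1.
have z1' : nrm (z^*)%C < 1 by rewrite nrm_conj.
have [v [hv ->]] := char_funE ST y z1'.
have aT a b : dot (T a) b = dot a (S b) by case: TS.
have aS a b : dot (S a) b = dot a (T b) by case: ST.
rewrite dotDl dotDr dotNl dotNr aT dotZl dotZr conjcK; congr (_ + z * _).
rewrite (defect_selfadjoint ST) -(defect_selfadjoint TS) -hu -hv.
by rewrite dotBl dotBr dotZl dotZr conjcK aS.
Qed.

End Contractions.

Arguments char_coef {R H} T S x n.

(** * Parseval's identity for trigonometric polynomials *)

Section UnitCircle.
Context {R : realType}.
Implicit Types (s t : R).

Definition expi t : R[i] := (cos t +i* sin t)%C.

Lemma expiD s t : expi (s + t) = expi s * expi t.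
Proof.
rewrite /expi cosD sinD; apply/eqP; rewrite eq_complex /=.
by rewrite eqxx /= addrC.
Qed.

Lemma expi0 : expi 0 = 1.
Proof. by rewrite /expi cos0 sin0. Qed.

Lemma expiX n t : expi t ^+ n = expi (n%:R * t).
Proof.
elim: n => [|n ih]; first by rewrite mul0r expi0 expr0.
by rewrite exprS ih -expiD -[in RHS]nat1r mulrDl mul1r.
Qed.

Lemma expi_conj t : ((expi t)^*)%C = expi (- t).
Proof. by rewrite /expi cosN sinN. Qed.

Lemma nrm_expi t : nrm (expi t) = 1.
Proof.
apply/eqP; rewrite -(@pexpr_eq1 _ _ 2) ?nrm_ge0 // nrm_sqr /= cos2Dsin2.
by [].
Qed.

Lemma nrm_real_expi (r t : R) : 0 <= r -> nrm (r%:C%C * expi t) = r.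
Proof. by move=> r0; rewrite nrmM nrmC nrm_expi mulr1 ger0_norm. Qed.

Lemma expi_2pi n : expi (pi *+ 2 *+ n) = 1.
Proof.
by rewrite -mulr_natl -expiX /expi cos2pi sin2pi expr1n.
Qed.

Lemma expi_periodic (m n k : nat) a :
  expi ((m%:R - n%:R) * (a + pi *+ 2 *+ k)) = expi ((m%:R - n%:R) * a).
Proof.
rewrite mulrDr expiD [X in _ * X](_ : _ = 1) ?mulr1 //.
rewrite mulrBl expiD.
have h j : expi (j%:R * (pi *+ 2 *+ k)) = 1.
  by rewrite -expiX expi_2pi expr1n.
by rewrite h mul1r -expi_conj h conjc1.
Qed.

Lemma cos_pi4 : cos (pi / 4 : R) ^+ 2 = 2^-1 /\ 0 < cos (pi / 4 : R).
Proof.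
have pp := pi_gt0 R.
split; last by apply: cos_gt0_pihalf; apply/andP; split; lra.
have := cos_pihalf R; rewrite (_ : pi / 2 = (pi / 4) *+ 2) ?cos_mulr2n; last first.
  rewrite -mulr_natr; lra.
rewrite -mulr_natr; lra.
Qed.

(** Halving the angle puts it in [[0, pi/4]], where the mean value theorem gives
    [sin y >= y cos (pi/4)]; then [sin x = 2 sin y cos y]. *)
Lemma sin_lower (x : R) : 0 <= x <= pi / 2 -> x / 2 <= sin x.
Proof.
move=> /andP[x0 xpi]; have pp := pi_gt0 R; have [c2 c0] := cos_pi4.
set c := cos _ in c2 c0; pose y := x / 2.
have ccos z : 0 <= z <= pi / 4 -> c <= cos z.
  move=> /andP[z0 z1]; have [->//|zn] := eqVneq z (pi / 4).
  have h1 : pi / 4 \in `[0, (pi : R)].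
    by rewrite in_itv /=; apply/andP; split; lra.
  have h2 : z \in `[0, (pi : R)] by rewrite in_itv /=; apply/andP; split; lra.
  by apply: ltW; rewrite /c ltr_cos // lt_neqAle zn.
have siny : y * c <= sin y.
  have [y0|y0] := leP y 0.
    by have -> : y = 0; [rewrite /y in y0 *; lra | rewrite mul0r sin0].
  have [|z] := @MVT _ sin cos 0 y y0 (fun z _ => is_derive_sin z).
    by apply: continuous_subspaceT; exact: continuous_sin.
  rewrite in_itv /= => /andP[z0 zy]; rewrite sin0 !subr0 => ->.
  rewrite mulrC ler_wpM2r ?(ltW y0) //; apply: ccos; rewrite /y in zy y0.
  by apply/andP; split; lra.
have cosy : c <= cos y by apply: ccos; rewrite /y; apply/andP; split; lra.
have -> : x = y *+ 2 by rewrite /y -mulr_natr; lra.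
have y0 : 0 <= y by rewrite /y; lra.
rewrite sin_mulr2n -[y *+ 2]mulr_natr -[(_ * _) *+ 2]mulr_natr.
have h1 : c * (y * c) <= cos y * sin y.
  by apply: ler_pM => //; [exact: ltW|rewrite mulr_ge0 // ltW].
have h2 : c * (y * c) = y * 2^-1 by rewrite -c2; ring.
lra.
Qed.

(** Keeps the Dirichlet kernel away from its singularity, through
    [|1 - e^(is)|^2 = 2 (1 - cos s)]. *)
Lemma cos_upper s : `|s| <= pi -> s ^+ 2 / 8 <= 1 - cos s.
Proof.
move=> spi; rewrite -(cos_norm s) -real_normK ?num_real //.
have s0 := normr_ge0 s; move: `|s| s0 spi => x x0 xpi.
have h : x / 2 / 2 <= sin (x / 2) by apply: sin_lower; apply/andP; split; lra.
have -> : cos x = cos ((x / 2) *+ 2) by congr cos; rewrite -mulr_natr; lra.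
rewrite cos_mulr2n -mulr_natr cos2sin2.
have : (x / 2 / 2) ^+ 2 <= sin (x / 2) ^+ 2.
  by rewrite ler_sqr ?nnegrE //; lra.
lra.
Qed.

Lemma nrm_1Bexpi s : nrm (1 - expi s) ^+ 2 = 2 - 2 * cos s.
Proof.
rewrite nrm_sqr /= add0r sqrrN.
have := cos2Dsin2 s; move: (cos s) (sin s) => a b; lra.
Qed.

End UnitCircle.

Section Primitives.
Context {R : realType}.

Definition primitive (F f : R -> R) := forall x : R, is_derive x 1 F (f x).

Lemma primitive_sum n (F f : nat -> R -> R) : (forall k, primitive (F k) (f k)) ->
  primitive (fun x => \sum_(k < n) F k x) (fun x => \sum_(k < n) f k x).
Proof.
move=> h x; elim: n => [|n ih].
  rewrite (_ : (fun x => _) = cst 0); last by apply/funext => y; rewrite big_ord0.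
  by rewrite big_ord0; exact: is_derive_cst.
rewrite (_ : (fun x => _) = (fun x => \sum_(k < n) F k x) + F n); last first.
  by apply/funext => y; rewrite big_ord_recr.
by rewrite big_ord_recr /=; apply: is_deriveD; exact: h.
Qed.

Lemma primitive_continuous F f : primitive F f -> continuous F.
Proof.
move=> h x; apply: differentiable_continuous; apply/derivable1_diffP.
by have [] := h x.
Qed.

Lemma integral_primitive F f a b : a < b -> primitive F f -> continuous f ->
  (\int[lebesgue_measure]_(x in `[a, b]) (f x)%:E = (F b - F a)%:E)%E.
Proof.
move=> ab h cf; rewrite EFinB; apply: continuous_FTC2 => //.
- exact: continuous_subspaceT.
- split.
  + by move=> x _; have [] := h x.
  + by apply: cvg_at_right_filter; exact: primitive_continuous h _.
  + by apply: cvg_at_left_filter; exact: primitive_continuous h _.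
- by move=> x _; rewrite derive1E; have [_] := h x.
Qed.

End Primitives.

Section Parseval.
Context {R : realType} {H : completeNormedModType R[i]}.
Variable dot : {dot H for Num.conj}.
Hypothesis hH : hilbert dot.
Implicit Types (c : nat -> H) (t a : R).

(** A polynomial with vector coefficients; on the unit circle it is an analytic
    trigonometric polynomial. *)
Definition vpoly M c (z : R[i]) : H := \sum_(k < M) z ^+ k *: c k.

Lemma dot_suml M c (y : H) (u : nat -> R[i]) :
  dot (\sum_(k < M) u k *: c k) y = \sum_(k < M) u k * dot (c k) y.
Proof.
elim: M => [|M ih]; first by rewrite !big_ord0 dot0l.
by rewrite !big_ord_recr /= dotDl dotZl ih.
Qed.

Lemma dot_sumr M c (y : H) (u : nat -> R[i]) :
  dot y (\sum_(k < M) u k *: c k) = \sum_(k < M) ((u k)^*)%C * dot y (c k).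
Proof.
elim: M => [|M ih]; first by rewrite !big_ord0 dot0r.
by rewrite !big_ord_recr /= dotDr dotZr ih.
Qed.

(** The real part of [e^(imt) e^(-int) dot (c m) (c n)]. *)
Definition cross c m n t : R :=
  complex.Re (dot (c m) (c n)) * cos ((m%:R - n%:R) * t) -
  complex.Im (dot (c m) (c n)) * sin ((m%:R - n%:R) * t).

Lemma vpoly_expi_sqr M c t : nrm (vpoly M c (expi t)) ^+ 2 =
  \sum_(m < M) \sum_(n < M) cross c m n t.
Proof.
rewrite -(ip_nrm hH) /ip /vpoly dot_suml raddf_sum /=; apply: eq_bigr => m _.
rewrite dot_sumr mulr_sumr raddf_sum /=; apply: eq_bigr => n _.
rewrite !expiX expi_conj mulrA -expiD -mulNr -mulrDl /cross.
by case: (dot _ _) => x y /=; rewrite mulrC [sin _ * _]mulrC.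
Qed.

Definition cross_primitive c m n t : R :=
  if m == n then complex.Re (dot (c m) (c n)) * t else
  (m%:R - n%:R)^-1 * (complex.Re (dot (c m) (c n)) * sin ((m%:R - n%:R) * t) +
  complex.Im (dot (c m) (c n)) * cos ((m%:R - n%:R) * t)).

Lemma cross_primitiveP c m n : primitive (cross_primitive c m n) (cross c m n).
Proof.
move=> x; rewrite /cross_primitive /cross.
set p := complex.Re _; set q := complex.Im _.
have [->|mn] := eqVneq m n.
  rewrite subrr mul0r cos0 sin0 mulr0 subr0 mulr1.
  by apply: is_derive_eq; rewrite /GRing.scale /= mulr1.
have w0 : m%:R - n%:R != 0 :> R by rewrite subr_eq0 eqr_nat.
set w := m%:R - n%:R in w0 *.
apply: is_derive_eq.
by rewrite /GRing.scale /=; field.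
Qed.

Lemma cross_continuous c m n : continuous (cross c m n).
Proof.
move=> x; rewrite /cross.
have lin : {for x, continuous (fun t : R => (m%:R - n%:R) * t)}.
  by apply: cvgMl_tmp; exact: cvg_id.
apply: cvgB; apply: cvgMl_tmp.
  exact: (continuous_comp lin (@continuous_cos R _)).
exact: (continuous_comp lin (@continuous_sin R _)).
Qed.

Lemma cross_sum_continuous M c :
  continuous (fun t => \sum_(m < M) \sum_(n < M) cross c m n t).
Proof.
move=> x; apply: cvg_big; first exact: add_continuous.
move=> m _; apply: cvg_big; first exact: add_continuous.
by move=> n _; exact: cross_continuous.
Qed.

Lemma vpoly_sqr_continuous M c : continuous (fun t => nrm (vpoly M c (expi t)) ^+ 2).
Proof.
rewrite (_ : (fun t => _) = fun t => \sum_(m < M) \sum_(n < M) cross c m n t).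
  exact: cross_sum_continuous.
by apply/funext => t; rewrite vpoly_expi_sqr.
Qed.

(** Integrate the double sum by an explicit primitive: the diagonal terms are
    linear in [t] and the others are periodic. *)
Lemma parseval M c a k : (0 < k)%N ->
  (\int[lebesgue_measure]_(t in `[a, (a + pi *+ 2 *+ k)%R])
     ((nrm (vpoly M c (expi t)) ^+ 2)%R)%:E =
   ((pi *+ 2 *+ k * \sum_(n < M) nrm (c n) ^+ 2)%R)%:E)%E.
Proof.
move=> k0; set T := pi *+ 2 *+ k.
have T0 : 0 < T.
  by rewrite /T -mulr_natr mulr_gt0 ?ltr0n // -mulr_natr mulr_gt0 ?pi_gt0 ?ltr0n.
pose F t := \sum_(m < M) \sum_(n < M) cross_primitive c m n t.
have pF : primitive F (fun t => \sum_(m < M) \sum_(n < M) cross c m n t).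
  apply: (@primitive_sum _ M (fun m t => \sum_(n < M) cross_primitive c m n t)
    (fun m t => \sum_(n < M) cross c m n t)) => m.
  apply: (@primitive_sum _ M (cross_primitive c m) (cross c m)) => n.
  exact: cross_primitiveP.
have aT : a < a + T by rewrite ltrDl.
have := integral_primitive aT pF (@cross_sum_continuous M c).
under eq_integral do rewrite -vpoly_expi_sqr.
move=> ->; congr EFin; rewrite /F -sumrB mulr_sumr; apply: eq_bigr => m _.
rewrite -sumrB (bigD1 m) //= big1 ?addr0.
  rewrite /cross_primitive eqxx -mulrBr addrAC subrr add0r mulrC; congr (_ * _).
  by rewrite -(ip_nrm hH).
move=> n nm; rewrite /cross_primitive eq_sym (negbTE (nm : (n : nat) != m)).
have := expi_periodic m n k a; rewrite -/T /expi => -[-> ->].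
by rewrite subrr.
Qed.

End Parseval.

(** * The radial maximal function of a polynomial *)

Section Kernel.
Context {R : realType}.
Implicit Types (s t r : R).

Definition dirichlet J s : R[i] := \sum_(j < J) expi s ^+ j.

Lemma dirichlet_le J s : nrm (dirichlet J s) ^+ 2 <= J%:R ^+ 2.
Proof.
rewrite ler_sqr ?nnegrE ?nrm_ge0 //; apply: le_trans (nrm_sum _ _ _) _.
under eq_bigr do rewrite nrmX nrm_expi expr1n.
by rewrite sumr_const card_ord.
Qed.

(** [(1 - e^(is)) times the kernel] is [1 - e^(iJs)], of modulus at most [2]. *)
Lemma dirichlet_decay J s : `|s| <= pi -> s ^+ 2 * nrm (dirichlet J s) ^+ 2 <= 16.
Proof.
move=> spi.
have h : nrm (1 - expi s) ^+ 2 * nrm (dirichlet J s) ^+ 2 <= 4.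
  rewrite -exprMn -nrmM -opprB mulNr -subrX1 nrmN (_ : 4 = 2 ^+ 2 :> R); last ring.
  rewrite ler_sqr ?nnegrE ?nrm_ge0 //; apply: le_trans (nrmD _ _) _.
  by rewrite nrmN nrmX nrm_expi expr1n nrmC normr1.
have := cos_upper spi; move: h; rewrite nrm_1Bexpi.
have := sqr_ge0 (nrm (dirichlet J s)); move: (nrm _ ^+ 2) (cos s) => a b; nra.
Qed.

(** The kernel is below a multiple of [J^2 min(1, (d/s)^2)], which is dominated
    by indicators of dyadic balls with geometric weights.  Only such indicators
    can be compared with the averages in the Hardy-Littlewood maximal function. *)
Lemma dirichlet_dyadic J (d : R) N s : (0 < J)%N -> d * J%:R = 4 ->
  `|s| <= pi -> pi < 2 ^+ N * d ->
  nrm (dirichlet J s) ^+ 2 <=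
  \sum_(i < N.+1) J%:R ^+ 2 * 4 / 4 ^+ i * (`|s| < 2 ^+ i * d)%R%:R.
Proof.
move=> J0 dJ spi hN.
have J0' : 0 < J%:R :> R by rewrite ltr0n.
have term_ge0 (i : nat) : 0 <= J%:R ^+ 2 * 4 / 4 ^+ i * (`|s| < 2 ^+ i * d)%R%:R :> R.
  by rewrite !mulr_ge0 ?exprn_ge0 ?invr_ge0 ?exprn_ge0 ?ler0n.
have ex : exists i, (`|s| < 2 ^+ i * d) && (i <= N)%N.
  by exists N; rewrite leqnn andbT; exact: le_lt_trans hN.
case: (ex_minnP ex) => i /andP[si iN] imin.
rewrite (bigD1 (Ordinal (iN : i < N.+1)%N)) //= si mulr1.
apply: (@le_trans _ _ (J%:R ^+ 2 * 4 / 4 ^+ i)); last by rewrite lerDl sumr_ge0.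
case: i si iN imin => [|i] si iN imin.
  rewrite expr0 divr1; apply: le_trans (dirichlet_le _ _) _.
  by have := sqr_ge0 (J%:R : R); lra.
have si' : 2 ^+ i * d <= `|s|.
  rewrite leNgt; apply/negP => h; have := imin i; rewrite h (ltnW iN) => /(_ isT).
  by rewrite ltnn.
have d0 : 0 < d by rewrite -(pmulr_lgt0 _ J0') dJ.
have w0 : 0 < 2 ^+ i * d by rewrite mulr_gt0 // exprn_gt0.
have sq : (2 ^+ i * d) ^+ 2 <= s ^+ 2.
  by rewrite -[s ^+ 2]real_normK ?num_real // ler_sqr // nnegrE ltW.
have := dirichlet_decay J spi; set a := nrm _ ^+ 2 => ha.
have a0 : 0 <= a by exact: sqr_ge0.
have h1 : (2 ^+ i * d) ^+ 2 * a <= 16 by apply: le_trans ha; rewrite ler_wpM2r.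
have h2 : 4 ^+ i = (2 ^+ i) ^+ 2 :> R by rewrite exprAC; congr (_ ^+ i); ring.
have e0 : 0 < (2 ^+ i : R) ^+ 2 by rewrite !exprn_gt0.
rewrite [4 ^+ _]exprS h2 invfM mulrA mulfK // ler_pdivlMr //.
have -> : J%:R ^+ 2 = 16 / d ^+ 2 :> R.
  have hh : (d * J%:R) ^+ 2 = 16 by rewrite dJ; ring.
  by rewrite -hh; field; rewrite gt_eqF.
by rewrite ler_pdivlMr ?exprn_gt0 // -mulrA -exprMn mulrC.
Qed.

Lemma bernoulli_ub k r : 0 <= r -> r <= 1 -> 1 - r ^+ k <= k%:R * (1 - r).
Proof.
move=> r0 r1; elim: k => [|k ih]; first by rewrite expr0 subrr mul0r.
rewrite exprS -nat1r.
have : 0 <= r ^+ k <= 1 by rewrite exprn_ge0 // exprn_ile1.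
have : r * (1 - r ^+ k) <= 1 - r ^+ k.
  by rewrite ler_piMl // subr_ge0 exprn_ile1.
move: (r ^+ k) ih => q; lra.
Qed.

(** Bernoulli's inequality, summed. *)
Lemma geometric_lower n r : 0 <= r -> r <= 1 ->
  n%:R - (1 - r) * n%:R ^+ 2 / 2 <= \sum_(j < n) r ^+ j.
Proof.
move=> r0 r1.
elim: n => [|n ih]; first by rewrite big_ord0 expr0n /= mulr0 mul0r subrr.
by rewrite big_ord_recr /= -nat1r; have := bernoulli_ub n r0 r1; move: ih; lra.
Qed.

End Kernel.

Section Domination.
Context {R : realType} {H : completeNormedModType R[i]}.
Variable dot : {dot H for Num.conj}.
Hypothesis hH : hilbert dot.
Implicit Types (c : nat -> H) (t r : R) (z : R[i]).

(** Products with scalar polynomials are handled through closure properties,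
    which avoids computing convolutions of coefficients. *)
Definition is_vpoly (G : R[i] -> H) := exists K g, forall z, G z = vpoly K g z.

Lemma vpolyS K (g : nat -> H) z :
  vpoly K.+1 g z = g 0 + z *: vpoly K (fun k => g k.+1) z.
Proof.
rewrite /vpoly big_ord_recl expr0 scale1r scaler_sumr; congr (_ + _).
by apply: eq_bigr => k _; rewrite scalerA -exprS.
Qed.

Lemma vpolyD K (g g' : nat -> H) z :
  vpoly K g z + vpoly K g' z = vpoly K (fun k => g k + g' k) z.
Proof.
by rewrite /vpoly -big_split /=; apply: eq_bigr => k _; rewrite scalerDr.
Qed.

Lemma vpoly_pad K L (g : nat -> H) z :
  vpoly K g z = vpoly (K + L) (fun k => if (k < K)%N then g k else 0) z.
Proof.
rewrite /vpoly big_split_ord /= [X in _ + X]big1 ?addr0.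
  by apply: eq_bigr => k _; rewrite ltn_ord.
by move=> k _; rewrite ltnNge leq_addr scaler0.
Qed.

Lemma is_vpoly_add G G' : is_vpoly G -> is_vpoly G' ->
  is_vpoly (fun z => G z + G' z).
Proof.
move=> [K [g hg]] [K' [g' hg']]; exists (K + K')%N; eexists => z.
by rewrite hg hg' (vpoly_pad K K') (vpoly_pad K' K) (addnC K' K) vpolyD.
Qed.

Lemma is_vpoly_scale (a : R[i]) G : is_vpoly G -> is_vpoly (fun z => a *: G z).
Proof.
move=> [K [g hg]]; exists K; exists (fun k => a *: g k) => z.
rewrite hg /vpoly scaler_sumr; apply: eq_bigr => k _.
by rewrite !scalerA mulrC.
Qed.

Lemma is_vpoly_mulX G : is_vpoly G -> is_vpoly (fun z => z *: G z).
Proof.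
move=> [K [g hg]]; exists K.+1; exists (fun k => if k is k'.+1 then g k' else 0) => z.
by rewrite vpolyS add0r hg.
Qed.

Lemma is_vpoly_geometric (a : R[i]) J G : is_vpoly G ->
  is_vpoly (fun z => (\sum_(j < J) (a * z) ^+ j) *: G z).
Proof.
move=> hG; elim: J => [|J ih].
  by exists 0%N; exists (fun=> 0) => z; rewrite /vpoly !big_ord0 scale0r.
have [K [g hg]] := is_vpoly_add hG (is_vpoly_mulX (is_vpoly_scale a ih)).
exists K; exists g => z; rewrite -hg big_ord_recl expr0 scalerDl scale1r.
congr (_ + _); rewrite !scalerA mulr_sumr; congr (_ *: _); apply: eq_bigr => j _.
by rewrite exprS [z * a]mulrC.
Qed.

(** Point evaluation on Hardy space.  In the induction on the number of
    coefficients, the difference of the two sides is the square of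
    [|z| a - (1 - |z|^2) B]. *)
Lemma vpoly_point_bound K (g : nat -> H) z : nrm z < 1 ->
  (1 - nrm z ^+ 2) * nrm (vpoly K g z) ^+ 2 <= \sum_(k < K) nrm (g k) ^+ 2.
Proof.
move=> z1; elim: K g => [|K ih] g.
  by rewrite /vpoly !big_ord0 nrm0 expr0n /= mulr0.
rewrite vpolyS big_ord_recl; have := ih (fun k => g k.+1).
set s := \sum_(k < K) _; set B := nrm (vpoly _ _ _) => hB.
have h1 : nrm (g 0 + z *: vpoly K (fun k => g k.+1) z) ^+ 2 <=
    (nrm (g 0) + nrm z * B) ^+ 2.
  rewrite ler_sqr ?nnegrE ?addr_ge0 ?mulr_ge0 ?nrm_ge0 //.
  by apply: le_trans (nrmD _ _) _; rewrite nrmZ.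
have z2 : 0 <= 1 - nrm z ^+ 2.
  by rewrite subr_ge0 exprn_ile1 ?nrm_ge0 // ltW.
have h2 := ler_wpM2l z2 h1.
have := sqr_ge0 (nrm z * nrm (g 0) - (1 - nrm z ^+ 2) * B).
move: h2 hB; rewrite /=; move: (nrm (g 0)) (nrm z) => a b; lra.
Qed.

(** Apply [vpoly_point_bound] at [r e^(i t0)] to the product of the polynomial
    with [sum_j (e^(-i t0) z)^j]: the extra factor is large at that point and
    concentrated near [t0] on the circle.  This replaces the Poisson kernel and
    keeps all sums finite. *)
Lemma vpoly_kernel_bound M c t0 r J : 0 <= r < 1 ->
  continuous (fun t =>
    nrm (dirichlet J (t - t0)) ^+ 2 * nrm (vpoly M c (expi t)) ^+ 2) /\
  ((pi *+ 2 * ((1 - r ^+ 2) * (\sum_(j < J) r ^+ j) ^+ 2 *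
     nrm (vpoly M c (r%:C%C * expi t0)) ^+ 2))%R%:E <=
  \int[lebesgue_measure]_(t in `[(t0 - pi)%R, (t0 - pi + pi *+ 2)%R])
     (nrm (dirichlet J (t - t0)) ^+ 2 * nrm (vpoly M c (expi t)) ^+ 2)%R%:E)%E.
Proof.
move=> /andP[r0 r1].
have vP : is_vpoly (vpoly M c) by exists M; exists c.
have [K [g hg]] := is_vpoly_geometric (expi (- t0)) J vP.
have E t : nrm (dirichlet J (t - t0)) ^+ 2 * nrm (vpoly M c (expi t)) ^+ 2 =
    nrm (vpoly K g (expi t)) ^+ 2.
  by rewrite -hg nrmZ exprMn -expiD addrC.
split.
  rewrite (_ : (fun t => _) = fun t => nrm (vpoly K g (expi t)) ^+ 2).
    exact: vpoly_sqr_continuous hH _ _.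
  by apply/funext => t; exact: E.
under eq_integral do rewrite E.
have := parseval hH K g (t0 - pi) (isT : 0 < 1)%N; rewrite mulr1n => ->.
have pp : 0 < pi *+ 2 :> R by rewrite -mulr_natr mulr_gt0 ?pi_gt0.
rewrite lee_fin ler_pM2l //.
have hz : nrm (r%:C%C * expi t0) = r by rewrite nrm_real_expi.
apply: le_trans (vpoly_point_bound K g (z := r%:C%C * expi t0) _); rewrite hz //.
rewrite -hg nrmZ exprMn mulrA.
rewrite (_ : \sum_(j < J) _ = (\sum_(j < J) r ^+ j)%:C%C); last first.
  rewrite rmorph_sum /=; apply: eq_bigr => j _.
  by rewrite mulrAC -expiD addNr expi0 mul1r rmorphXn.
by rewrite nrmC ger0_norm ?mulrA // sumr_ge0 // => j _; rewrite exprn_ge0.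
Qed.

End Domination.

Section RadialMaximal.
Context {R : realType} {H : completeNormedModType R[i]}.
Variable dot : {dot H for Num.conj}.
Hypothesis hH : hilbert dot.
Implicit Types (c : nat -> H) (t r : R) (z : R[i]).
Local Notation mu := (@lebesgue_measure R).

Lemma HL_ball_le (f : R -> R) x (r L : R) : 0 < r -> (HL_maximal f x <= L%:E)%E ->
  (\int[mu]_(y in ball x r) `|(f y)%:E| <= (2 * r * L)%:E)%E.
Proof.
move=> r0 hL.
have h : (iavg f (ball x r) <= L%:E)%E.
  apply: le_trans hL; apply: ereal_sup_ubound; exists r => //.
  by rewrite /= in_itv /= r0.
move: h; rewrite /iavg lebesgue_measure_ball ?(ltW r0) // inver.
have r2 : 0 < r *+ 2 by rewrite -mulr_natr mulr_gt0.
rewrite gt_eqF // lee_pdivrMl // -EFinM => /le_trans; apply.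
by rewrite lee_fin -[r *+ 2]mulr_natr [r * 2]mulrC.
Qed.

(** The length of the Dirichlet kernel that matches the distance to the
    boundary: [J] is comparable to [1 / (1 - r)]. *)
Lemma radius_scale r : 0 <= r < 1 -> exists J : nat,
  [/\ (0 < J)%N, J%:R * (1 - r) <= 1 & 1 <= 2 * J%:R * (1 - r)].
Proof.
move=> /andP[r0 r1]; have d0 : 0 < 1 - r by rewrite subr_gt0.
have q1 : 1 <= (1 - r)^-1 by rewrite invf_ge1 //; lra.
have /andP[h1 h2] := truncn_itv (le_trans ler01 q1).
exists (Num.trunc (1 - r)^-1); set J := Num.trunc _ in h1 h2 *.
have J0 : (0 < J)%N.
  by rewrite lt0n; apply/negP => /eqP J0; move: h2; rewrite J0 ltNge q1.
split=> //; first by rewrite -ler_pdivlMr // div1r.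
rewrite -ler_pdivrMr // div1r; apply: le_trans (ltW h2) _.
have : 1 <= J%:R :> R by rewrite ler1n.
by rewrite -nat1r; lra.
Qed.

Lemma geometric_half_sum n : \sum_(i < n) (2^-1 : R) ^+ i <= 2.
Proof.
suff -> : \sum_(i < n) (2^-1 : R) ^+ i = 2 - 2 * 2^-1 ^+ n.
  by rewrite lerBlDr lerDl mulr_ge0 // exprn_ge0 // invr_ge0.
elim: n => [|n ih]; first by rewrite big_ord0 expr0; ring.
by rewrite big_ord_recr /= ih exprS; field.
Qed.

(** The radial maximal function of a polynomial is controlled by the
    Hardy-Littlewood maximal function of its squared norm on the circle.  The
    window [[-B, B]] contains a full period around [t0]. *)
Lemma radial_domination M c t0 r (B L : R) : 0 <= r < 1 -> 0 <= L ->
  - B <= t0 - pi -> t0 + pi <= B ->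
  (HL_maximal ((fun t => nrm (vpoly M c (expi t)) ^+ 2)%R \_ `[(- B)%R, B]) t0 <= L%:E)%E ->
  nrm (vpoly M c (r%:C%C * expi t0)) ^+ 2 <= 128 * L.
Proof.
move=> r01 L0 hB1 hB2; set phi := (fun t => nrm _ ^+ 2); set psi := _ \_ _ => hL.
have [J [J0 Jr1 Jr2]] := radius_scale r01.
have [kc kb] := vpoly_kernel_bound hH M c t0 J r01.
have pp := pi_gt0 R.
have J0' : 0 < J%:R :> R by rewrite ltr0n.
(* [4] makes [J d = 4], so that [16 / s^2 = J^2 (d / s)^2]. *)
pose d : R := 4 / J%:R.
have d0 : 0 < d by rewrite divr_gt0.
have dJ : d * J%:R = 4 by rewrite /d divfK // gt_eqF.
have [N hN] : exists N, pi < 2 ^+ N * d.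
  exists (Num.trunc (pi / d)).+1; rewrite -ltr_pdivrMr //.
  apply: lt_le_trans (truncnS_gt _) _; rewrite -natrX ler_nat.
  exact/ltnW/ltn_expl.
have cphi : continuous phi by exact: vpoly_sqr_continuous hH _ _.
have mphi : measurable_fun setT phi by exact: continuous_measurable_fun.
have mpsi : measurable_fun setT psi.
  by apply/(measurable_restrictT _ _).1 => //; exact: measurable_funTS.
pose rho i : R := 2 ^+ i * d.
have rho0 i : 0 < rho i by rewrite mulr_gt0 // exprn_gt0.
pose a i : R := J%:R ^+ 2 * 4 / 4 ^+ i.
have a0 i : 0 <= a i by rewrite !mulr_ge0 ?exprn_ge0 ?invr_ge0 ?exprn_ge0.
pose g i : R -> \bar R := (fun t => `|(psi t)%:E|%E) \_ (ball t0 (rho i)).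
have g0 i t : (0 <= g i t)%E by rewrite /g patchE; case: ifP.
have mg i : measurable_fun setT (g i).
  apply/(measurable_restrictT _ _).1; first exact: measurable_ball.
  by apply: measurable_funTS; do 2 apply: measurableT_comp => //.
set I := `[(t0 - pi)%R, (t0 - pi + pi *+ 2)%R]%classic in kb.
have mI : measurable I by exact: measurable_itv.
have II t : I t -> `|t - t0| <= pi.
  rewrite /I /= in_itv /= => /andP[]; rewrite -mulr_natr ler_norml => h1 h2.
  by apply/andP; split; lra.
have phipsi t : I t -> psi t = phi t.
  move=> /II; rewrite ler_norml => /andP[h1 h2]; rewrite /psi patchE mem_set //.
  by rewrite /= in_itv /=; apply/andP; split; lra.
(* On the period around [t0] the kernel is replaced by dyadic indicators. *)
have step1 : (\int[mu]_(t in I) (nrm (dirichlet J (t - t0)) ^+ 2 * phi t)%R%:E <=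
   \int[mu]_(t in I) \sum_(i < N.+1) (a i)%:E * g i t)%E.
  apply: ge0_le_integral => //.
  - by move=> t _; rewrite lee_fin mulr_ge0 // sqr_ge0.
  - apply: measurable_funTS; apply: measurableT_comp => //.
    exact: continuous_measurable_fun.
  - apply: measurable_funTS; apply: emeasurable_sum => i.
    exact: (measurable_funeM _ (mg i)).
  - move=> t It.
    rewrite (eq_bigr (fun i : 'I_N.+1 => (a i * (`|t - t0| < 2 ^+ i * d)%R%:R * phi t)%:E)).
      rewrite sumEFin lee_fin -mulr_suml ler_wpM2r ?sqr_ge0 //.
      by apply: dirichlet_dyadic => //; exact: II.
    move=> i _; rewrite /g patchE phipsi // -/(rho i).
    rewrite (_ : (t \in _) = (`|t - t0| < rho i)).
      by case: ltP; rewrite ?mulr1 ?mulr0 ?mul0r ?mule0 // -EFinM ger0_norm ?sqr_ge0.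
    by apply/idP/idP; rewrite inE /ball /= distrC.
(* Each indicator contributes an average over a ball centred at [t0]. *)
have step2 : (\int[mu]_(t in I) \sum_(i < N.+1) (a i)%:E * g i t <=
   \sum_(i < N.+1) (a i * (2 * rho i * L))%:E)%E.
  apply: (@le_trans _ _ (\int[mu]_(t in setT) \sum_(i < N.+1) (a i)%:E * g i t)%E).
    apply: ge0_subset_integral => //.
    - by apply: emeasurable_sum => i; exact: (measurable_funeM _ (mg _)).
    - by move=> t _; apply: sume_ge0 => i _; rewrite mule_ge0 // lee_fin.
  rewrite ge0_integral_sum //; first last.
  - by move=> i t _; rewrite mule_ge0 // lee_fin.
  - by move=> i; exact: (measurable_funeM _ (mg _)).
  apply: lee_sum => i _; rewrite ge0_integralZl_EFin //; last exact: mg.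
  rewrite (EFinM (a i)); apply: lee_pmul => //; rewrite ?lee_fin //.
    by apply: integral_ge0.
  by rewrite /g -integral_mkcond; exact: HL_ball_le.
have := le_trans kb (le_trans step1 step2).
rewrite sumEFin lee_fin /rho /a.
have -> : \sum_(i < N.+1) J%:R ^+ 2 * 4 / 4 ^+ i * (2 * (2 ^+ i * d) * L) =
    J%:R * 32 * L * \sum_(i < N.+1) (2^-1 : R) ^+ i.
  rewrite mulr_sumr; apply: eq_bigr => i _.
  rewrite /d (_ : 4 ^+ i = 2 ^+ i * 2 ^+ i :> R) ?exprVn; last first.
    by rewrite -exprMn; congr (_ ^+ i); ring.
  field; rewrite (gt_eqF J0') /= expf_neq0 //.
set X := nrm _ ^+ 2 => key.
have X0 : 0 <= X by exact: sqr_ge0.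
have key2 : pi *+ 2 * ((1 - r ^+ 2) * (\sum_(j < J) r ^+ j) ^+ 2 * X) <= J%:R * 64 * L.
  apply: le_trans key _; have := geometric_half_sum N.+1.
  move=> /(ler_wpM2l (_ : 0 <= J%:R * 32 * L)); rewrite !mulr_ge0 //.
  by move=> /(_ isT) /le_trans; apply; lra.
case/andP: r01 => r0 r1.
have hS : J%:R / 2 <= \sum_(j < J) r ^+ j.
  apply: le_trans (geometric_lower J r0 (ltW r1)).
  have : (1 - r) * J%:R ^+ 2 <= J%:R by rewrite expr2 mulrA [(1 - r) * _]mulrC ler_piMl.
  lra.
have hS2 : (J%:R / 2) ^+ 2 <= (\sum_(j < J) r ^+ j) ^+ 2.
  by rewrite ler_sqr // nnegrE ?divr_ge0 // (le_trans _ hS) // divr_ge0.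
have hr : (2 * J%:R)^-1 <= 1 - r ^+ 2.
  apply: (@le_trans _ _ (1 - r)); last by rewrite lerD2l lerN2 expr2 ler_piMl // ltW.
  by rewrite invf_ple ?posrE ?mulr_gt0 ?subr_gt0 // -[X in X <= _]div1r ler_pdivrMr ?subr_gt0.
have k1 : (2 * J%:R)^-1 * (J%:R / 2) ^+ 2 <= (1 - r ^+ 2) * (\sum_(j < J) r ^+ j) ^+ 2.
  by apply: ler_pM => //; rewrite ?invr_ge0 ?mulr_ge0 ?sqr_ge0.
have k2 : (2 * J%:R)^-1 * (J%:R / 2) ^+ 2 = J%:R / 8 :> R by field; rewrite gt_eqF.
rewrite k2 in k1.
have k3 : 4 * (J%:R / 8 * X) <= J%:R * 64 * L.
  apply: le_trans key2; apply: ler_pM => //.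
  - by rewrite mulr_ge0 // divr_ge0.
  - by rewrite -mulr_natr; have := pi_ge2 R; lra.
  - by rewrite ler_wpM2r.
by rewrite -(ler_pM2l J0'); lra.
Qed.

End RadialMaximal.

(** * Radial limits almost everywhere *)

Section Negligible.
Context {R : realType}.
Local Notation mu := (@lebesgue_measure R).

(** Continuity of the measure from below along the increasing intersections. *)
Lemma measure_liminf_le (W : nat -> set R) (b : \bar R) :
  (forall n, measurable (W n)) -> (forall n, mu (W n) <= b)%E ->
  measurable (\bigcup_K \bigcap_(n >= K) W n) /\
  (mu (\bigcup_K \bigcap_(n >= K) W n) <= b)%E.
Proof.
move=> mW bW; pose F K := \bigcap_(n >= K) W n.
have mF K : measurable (F K) by apply: bigcap_measurable => [|n _]; [exists K => /=|exact: mW].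
have mU : measurable (\bigcup_K F K) by exact: bigcupT_measurable.
split=> //.
have nd : {homo F : n m / (n <= m)%N >-> (n <= m)%O}.
  move=> n m nm; apply/subsetPset => x Fx k /= mk; apply: Fx.
  exact: leq_trans nm mk.
have := nondecreasing_cvg_mu (mu := mu) mF mU nd.
move=> /cvg_lim <- //; apply: lime_le.
  by apply/cvg_ex; eexists; exact: (nondecreasing_cvg_mu (mu := mu) mF mU nd).
apply: nearW => K; apply: le_trans (bW K).
apply: le_measure; [rewrite inE; exact: mF|rewrite inE; exact: mW|move=> x Fx].
exact: (Fx K (leqnn K)).
Qed.

Lemma negligible_eps (E : set R) :
  (forall e : R, 0 < e -> exists V, [/\ measurable V, E `<=` V & (mu V <= e%:E)%E]) ->
  mu.-negligible E.
Proof.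
move=> h.
have pos n : 0 < (n.+1%:R : R)^-1 by rewrite invr_gt0.
have [V hV] := choice (fun n => h _ (pos n)).
have mI : measurable (\bigcap_n V n) by apply: bigcapT_measurable => n; case: (hV n).
exists (\bigcap_n V n); split=> //; last by move=> x Ex n _; case: (hV n) => _ + _; apply.
apply/eqP; rewrite eq_le measure_ge0 andbT.
apply/lee_addgt0Pr => e e0; rewrite add0e.
have [n hn] : exists n : nat, (n.+1%:R)^-1 <= e.
  exists (Num.trunc e^-1); rewrite invf_ple ?posrE //.
  exact/ltW/truncnS_gt.
apply: (@le_trans _ _ (mu (V n))).
  apply: le_measure; [by rewrite inE|by rewrite inE; case: (hV n)|].
  by move=> x Vx; exact: (Vx n).
by case: (hV n) => _ _ /le_trans; apply; rewrite lee_fin.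
Qed.

End Negligible.

Section Fatou.
Context {R : realType} {H : completeNormedModType R[i]}.
Variable dot : {dot H for Num.conj}.
Hypothesis hH : hilbert dot.
Implicit Types (c : nat -> H) (f : R[i] -> H) (t r : R) (z : R[i]).
Local Notation mu := (@lebesgue_measure R).

Definition weak_constant k : R := 3 * 128 * (pi *+ 2 *+ k.+1).

(** The weak type inequality of Hardy and Littlewood, with the integral of the
    squared norm computed by Parseval. *)
Lemma weak_type M c k (l : R) : 0 < l -> exists W,
  [/\ measurable W,
    (mu W <= (weak_constant k / l ^+ 2 * \sum_(n < M) nrm (c n) ^+ 2)%:E)%E &
    forall t r, `|t| <= pi *+ k -> 0 <= r < 1 ->
      l < nrm (vpoly M c (r%:C%C * expi t)) -> W t].
Proof.
move=> l0; pose B : R := pi *+ k.+1.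
set phi := fun t => nrm (vpoly M c (expi t)) ^+ 2; pose psi := phi \_ `[- B, B].
have cphi : continuous phi by exact: vpoly_sqr_continuous hH _ _.
have l2 : 0 < l ^+ 2 / 128 by rewrite divr_gt0 // exprn_gt0.
have B0 : 0 < B by rewrite /B -mulr_natr mulr_gt0 ?pi_gt0.
have mI : measurable `[- B, B] by exact: measurable_itv.
have iphi : mu.-integrable `[- B, B] (EFin \o phi).
  apply: continuous_compact_integrable; first exact: segment_compact.
  exact: continuous_subspaceT.
have lpsi : locally_integrable setT psi by exact: integrable_locally.
exists [set t | (HL_maximal psi t > (l ^+ 2 / 128)%:E)%E]; split.
- rewrite -[X in measurable X]setTI; apply: emeasurable_fun_o_infty => //.
  exact: measurable_HL_maximal.
- apply: le_trans (maximal_inequality lpsi l2) _.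
  have -> : (\int[mu]_(y in setT) `|(psi y)%:E| = \int[mu]_(y in `[(- B)%R, B]) (phi y)%:E)%E.
    rewrite [RHS]integral_mkcond; apply: eq_integral => y _.
    rewrite /psi !patchE; case: ifP => _ /=; last by rewrite normr0.
    by rewrite ger0_norm ?sqr_ge0.
  have := parseval hH M c (- B) (isT : 0 < k.+1)%N.
  have -> : - B + pi *+ 2 *+ k.+1 = B by rewrite mulrnAC -/B mulr2n addrA addNr add0r.
  move=> ->; rewrite -EFinM lee_fin /weak_constant.
  rewrite le_eqVlt; apply/orP; left; apply/eqP; field.
  by rewrite gt_eqF.
- move=> t r tk r01 lP /=; rewrite ltNge; apply/negP => hL.
  have := radial_domination hH r01 (ltW l2) _ _ hL.
  move: tk; rewrite ler_norml => /andP[t1 t2].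
  have -> : 128 * (l ^+ 2 / 128) = l ^+ 2 by field.
  rewrite /B mulrS opprD => h; have : nrm (vpoly M c (r%:C%C * expi t)) ^+ 2 <= l ^+ 2.
    by apply: h; lra.
  by rewrite ler_sqr ?nnegrE ?nrm_ge0 ?(ltW l0) // leNgt lP.
Qed.

(** [f] is the sum of the power series with coefficients [c] in the unit disc,
    with a geometric bound on the remainders. *)
Definition disc_series f c := exists C : R, forall z M, nrm z < 1 ->
  nrm (f z - vpoly M c z) <= C * (nrm z ^+ M / (1 - nrm z)).

Definition tail_coef N c n : H := if (n < N)%N then 0 else c n.

Lemma vpoly_tail N M c z : (N <= M)%N ->
  vpoly M (tail_coef N c) z = vpoly M c z - vpoly N c z.
Proof.
move=> NM; rewrite (vpoly_pad N (M - N)) subnKC // /vpoly -sumrB.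
apply: eq_bigr => n _; rewrite /tail_coef; case: ifP => _.
  by rewrite scaler0 subrr.
by rewrite scaler0 subr0.
Qed.

Lemma geometric_eps (q C e : R) : 0 <= q < 1 -> 0 < e ->
  exists N, forall n, (N <= n)%N -> C * q ^+ n < e.
Proof.
move=> /andP[q0 q1] e0.
have h : q ^+ n * C @[n --> \oo] --> (0 : R).
  rewrite -[X in _ --> X](mul0r C); apply: cvgMr_tmp; apply: cvg_expr.
  by rewrite ger0_norm.
have [N _ hN] := (cvgrPdist_lt _ _).1 h e e0.
exists N => n Nn; have := hN n Nn; rewrite sub0r normrN mulrC.
exact/le_lt_trans/ler_norm.
Qed.

(** A point where the remainder of [f] exceeds [l] on the radius is eventually
    such a point for the partial sums, and these have uniform bounds. *)
Lemma tail_weak_type f c N k (l b : R) : disc_series f c -> 0 < l ->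
  (forall M, \sum_(n < M) nrm (tail_coef N c n) ^+ 2 <= b) -> exists V,
  [/\ measurable V, (mu V <= (weak_constant k / l ^+ 2 * b)%:E)%E &
    forall t r, `|t| <= pi *+ k -> 0 <= r < 1 ->
      l < nrm (f (r%:C%C * expi t) - vpoly N c (r%:C%C * expi t)) -> V t].
Proof.
move=> [C hC] l0 hb.
have [W hW] := choice (fun M => weak_type M (tail_coef N c) k l0).
have K0 : 0 <= weak_constant k / l ^+ 2.
  apply: divr_ge0; last exact: sqr_ge0.
  by apply: mulr_ge0 => //; do 2!apply: mulrn_wge0; exact: pi_ge0.
have [||mV bV] := @measure_liminf_le _ W (weak_constant k / l ^+ 2 * b)%:E.
- by move=> n; case: (hW n).
- move=> n; case: (hW n) => _ /le_trans h _; apply: h.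
  by rewrite lee_fin ler_wpM2l.
exists (\bigcup_K \bigcap_(n >= K) W n); split=> // t r tk r01 hl.
have /andP[r0 r1] := r01.
set z := r%:C%C * expi t in hl *.
have nz : nrm z = r by rewrite nrm_real_expi.
set g := nrm (f z - vpoly N c z) in hl.
have gl : 0 < g - l by rewrite subr_gt0.
have [K hK] := geometric_eps (C / (1 - r)) r01 gl.
exists (maxn N K) => // M /=; rewrite geq_max => /andP[NM KM].
have [_ _ h] := hW M; apply: (h t r) => //; rewrite -/z vpoly_tail //.
have h1 : nrm (f z - vpoly M c z) < g - l.
  apply: le_lt_trans (hC z M _) _; first by rewrite nz.
  by rewrite nz mulrA mulrAC; exact: hK.
have := nrm_tri (f z) (vpoly M c z) (vpoly N c z); rewrite -/g; lra.
Qed.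

End Fatou.

Section Boundary.
Context {R : realType} {H : completeNormedModType R[i]}.
Variable dot : {dot H for Num.conj}.
Hypothesis hH : hilbert dot.
Implicit Types (c : nat -> H) (f : R[i] -> H) (t r : R) (z : R[i]).
Local Notation mu := (@lebesgue_measure R).

Definition radial f t r : H := f (r%:C%C * expi t).

Lemma square_tail c (b e : R) :
  (forall M, \sum_(n < M) nrm (c n) ^+ 2 <= b) -> 0 < e ->
  exists N, forall M, \sum_(n < M) nrm (tail_coef N c n) ^+ 2 <= e.
Proof.
move=> hb e0; pose s M := \sum_(n < M) nrm (c n) ^+ 2.
have hs : has_sup (range s).
  by split; [exists (s 0%N); exists 0%N|exists b => _ [M _ <-]; exact: hb].
have [_ [N _ <-] hN] := @sup_adherent _ (range s) e e0 hs.
exists N => M; have [MN|/ltnW NM] := leqP M N.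
  rewrite big1 ?(ltW e0) // => n _.
  by rewrite /tail_coef (leq_trans (ltn_ord n) MN) nrm0 expr0n.
have : s M <= sup (range s) by apply: sup_upper_bound => //; exists M.
have -> : s M = s N + \sum_(n < M) nrm (tail_coef N c n) ^+ 2.
  rewrite /s -(subnKC NM) !big_split_ord /=; congr (_ + _).
  rewrite [X in _ = X + _]big1 ?add0r.
    by apply: eq_bigr => n _; rewrite /tail_coef ltnNge leq_addr.
  by move=> n _; rewrite /tail_coef ltn_ord nrm0 expr0n.
lra.
Qed.

Lemma vpoly_radial N c t r : 0 <= r -> r <= 1 ->
  nrm (vpoly N c (expi t) - vpoly N c (r%:C%C * expi t)) <=
  (1 - r) * \sum_(n < N) n%:R * nrm (c n).
Proof.
move=> r0 r1; rewrite /vpoly -sumrB mulr_sumr; apply: le_trans (nrm_sum _ _ _) _.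
apply: ler_sum => n _; rewrite -scalerBl nrmZ exprMn.
have -> : expi t ^+ n - r%:C%C ^+ n * expi t ^+ n = (1 - r ^+ n)%:C%C * expi t ^+ n.
  by rewrite rmorphB rmorph1 rmorphXn mulrBl mul1r.
rewrite nrmM nrmC nrmX nrm_expi expr1n mulr1 ger0_norm.
  by rewrite mulrA ler_wpM2r ?nrm_ge0 // [(1 - r) * _]mulrC bernoulli_ub.
by rewrite subr_ge0 exprn_ile1.
Qed.

(** Failure of the Cauchy criterion: no vector [y] is close to all the values
    near the boundary. *)
Lemma not_cvg_radial f t : ~ cvg (radial f t r @[r --> 1^'-]) ->
  exists2 e : R, 0 < e &
    forall y (d : R), 0 < d -> exists r, [/\ 0 <= r < 1, 1 - r < d &
      e <= nrm (y - radial f t r)].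
Proof.
move=> h; apply: contrapT => h2; apply: h; apply: cauchy_cvg; apply: cauchy_exP.
move=> eps eps0.
have eE : eps = (complex.Re eps)%:C%C by rewrite RRe_real ?gtr0_real.
have e0 : 0 < complex.Re eps by rewrite -ltcR -eE.
move/forall2NP : h2 => /(_ (complex.Re eps)) [//|] /existsNP [y] /existsNP [d].
move=> /not_implyP [d0 hr]; exists y.
have key : \forall r \near 1^'-, ball y eps (radial f t r).
  near=> r; rewrite -ball_normE /= nrmE eE ltcR ltNge; apply/negP => h.
  apply: hr; exists r; split=> //.
    apply/andP; split; first by near: r; apply: nbhs_left_ge.
    by near: r; exact: nbhs_left_lt.
  rewrite ltrBlDr -ltrBlDl; near: r; apply: nbhs_left_gt.
  by rewrite ltrBlDr ltrDl.
exact: key.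
Unshelve. all: by end_near. Qed.

(** Compare [f] on a bad radius with the boundary value of its [N]th partial
    sum: the remainder must be large there.  The set of such points has
    measure at most a multiple of the tail of the square sum. *)
Lemma fatou_window f c (b : R) k : disc_series f c ->
  (forall M, \sum_(n < M) nrm (c n) ^+ 2 <= b) ->
  mu.-negligible [set t | `|t| <= pi *+ k /\ ~ cvg (radial f t r @[r --> 1^'-])].
Proof.
move=> hf hb.
pose E (j : nat) := [set t | `|t| <= pi *+ k /\ forall y (d : R), 0 < d ->
  exists r, [/\ 0 <= r < 1, 1 - r < d & j.+1%:R^-1 <= nrm (y - radial f t r)]].
set X := [set t | _].
have sub : X `<=` \bigcup_j E j.
  move=> t [tk /not_cvg_radial [e e0 he]].
  exists (Num.trunc e^-1) => //; split=> // y d d0.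
  have [r [? ? h]] := he y d d0; exists r; split=> //; apply: le_trans h.
  by rewrite invf_ple ?posrE //; exact/ltW/truncnS_gt.
apply: (@negligibleS _ _ _ mu _ _ sub); apply: negligible_bigcup => j; apply: negligible_eps => e e0.
(* One quarter of the oscillation leaves room for the boundary error [l]. *)
pose l : R := j.+1%:R^-1 / 4.
have l0 : 0 < l by rewrite divr_gt0 // invr_gt0.
have K0 : 0 < weak_constant k :> R.
  by apply: mulr_gt0; rewrite // -mulr_natr mulr_gt0 // -mulr_natr mulr_gt0 ?pi_gt0.
have e1 : 0 < e * (l ^+ 2 / weak_constant k).
  by rewrite mulr_gt0 // divr_gt0 // exprn_gt0.
have [N hN] := square_tail hb e1.
have [V [mV bV hV]] := tail_weak_type hH k hf l0 hN.
exists V; split=> //; last first.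
  apply: le_trans bV _; rewrite lee_fin le_eqVlt; apply/orP; left; apply/eqP.
  by field; rewrite !gt_eqF.
move=> t [tk ht].
pose A : R := \sum_(n < N) n%:R * nrm (c n).
have A0 : 0 <= A by apply: sumr_ge0 => n _; rewrite mulr_ge0 // nrm_ge0.
have d0 : 0 < l / (A + 1) by rewrite divr_gt0 // ltr_wpDl.
have [r [r01 rd hr]] := ht (vpoly N c (expi t)) _ d0.
apply: (hV t r tk r01).
have /andP[r0 r1] := r01.
have h1 := vpoly_radial N c t r0 (ltW r1); rewrite -/A in h1.
have h2 : (1 - r) * A <= l.
  move: rd; rewrite ltr_pdivlMr; last by rewrite ltr_wpDl.
  have : 0 <= 1 - r by lra.
  nra.
have := nrm_tri (vpoly N c (expi t)) (vpoly N c (r%:C%C * expi t)) (radial f t r).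
rewrite [nrm (vpoly N c (r%:C%C * _) - _)]nrm_distC /radial.
have : j.+1%:R^-1 = 4 * l by rewrite /l; field.
move: hr h1 h2; rewrite /radial; move: (j.+1%:R^-1) => u; clearbody l; lra.
Qed.

Lemma ae_windows (P : R -> Prop) :
  (forall k, mu.-negligible [set t | `|t| <= pi *+ k /\ ~ P t]) ->
  {ae mu, forall t, P t}.
Proof.
move=> h; have sub : ~` [set t | P t] `<=` \bigcup_k
    [set t | `|t| <= pi *+ k /\ ~ P t].
  move=> t /= nPt; exists (Num.trunc `|t|).+1 => //; split=> //.
  apply: le_trans (ltW (truncnS_gt _)) _.
  rewrite -[leRHS]mulr_natl ler_peMr //; have := pi_ge2 R; lra.
by apply: (@negligibleS _ _ _ mu _ _ sub); exact: negligible_bigcup.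
Qed.

Theorem fatou_radial f c (b : R) : disc_series f c ->
  (forall M, \sum_(n < M) nrm (c n) ^+ 2 <= b) ->
  {ae mu, forall t, cvg (radial f t r @[r --> 1^'-])}.
Proof. by move=> hf hb; apply: ae_windows => k; exact: fatou_window hb. Qed.

End Boundary.

(** * Norms of the boundary values *)

Section BoundaryNorm.
Context {R : realType} {H : completeNormedModType R[i]}.
Variable dot : {dot H for Num.conj}.
Hypothesis hH : hilbert dot.
Implicit Types (c : nat -> H) (f : R[i] -> H) (t r : R) (z : R[i]).
Local Notation mu := (@lebesgue_measure R).

Definition radius (k : nat) : R := 1 - k.+2%:R^-1.

Lemma radius_itv k : 0 <= radius k < 1.
Proof.
have h0 : 0 < (k.+2%:R : R)^-1 by rewrite invr_gt0.
have h1 : (k.+2%:R : R)^-1 <= 1 by rewrite invf_ple ?posrE // invr1 ler1n.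
by rewrite /radius; apply/andP; split; move: (k.+2%:R^-1) h0 h1 => u; lra.
Qed.

Lemma radius_cvg : radius k @[k --> \oo] --> (1 : R).
Proof.
rewrite -[X in _ --> X]subr0; apply: cvgB; first exact: cvg_cst.
by have := @cvg_harmonic R; rewrite -(cvg_shiftS (@harmonic R)).
Qed.

Lemma radiusX_cvg n : radius k ^+ n @[k --> \oo] --> (1 : R).
Proof.
elim: n => [|n ih]; first by under eq_fun do rewrite expr0; exact: cvg_cst.
under eq_fun do rewrite exprS.
have h : radius k * radius k ^+ n @[k --> \oo] --> (1 * 1 : R).
  by apply: cvgM ih; exact: radius_cvg.
by rewrite mulr1 in h.
Qed.

Lemma radius_at_left : radius k @[k --> \oo] --> (1 : R)^'-.
Proof.
move=> A hA; have := radius_cvg hA => /=.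
rewrite /nbhs /=; apply: filterS => k; apply.
by case/andP: (radius_itv k).
Qed.

(** Partial sums at radii tending to [1] have the same limits as [f] itself, and
    their integrals are given by Parseval's identity for polynomials. *)
Lemma approximants f c : disc_series f c -> exists m : nat -> nat, forall k,
  (k <= m k)%N /\ forall t,
    nrm (radial f t (radius k) - vpoly (m k) c ((radius k)%:C%C * expi t)) <=
      k.+1%:R^-1.
Proof.
move=> [C hC].
suff h k : exists M, (k <= M)%N /\ forall t,
    nrm (radial f t (radius k) - vpoly M c ((radius k)%:C%C * expi t)) <= k.+1%:R^-1.
  by have [m hm] := choice h; exists m.
have k0 : 0 < (k.+1%:R : R)^-1 by rewrite invr_gt0.
have [N hN] := geometric_eps (C / (1 - radius k)) (radius_itv k) k0.
have /andP[r0 r1] := radius_itv k.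
exists (maxn k N); split; first exact: leq_maxl.
move=> t; apply: le_trans (hC _ _ _) _; rewrite nrm_real_expi //.
by rewrite mulrA mulrAC ltW // hN // leq_maxr.
Qed.

Lemma vpoly_dilate M c r t :
  vpoly M c (r%:C%C * expi t) = vpoly M (fun n => (r ^+ n)%:C%C *: c n) (expi t).
Proof.
apply: eq_bigr => n _; rewrite scalerA exprMn mulrC rmorphXn //.
Qed.

Lemma approximant_cvg f c m t (l : H) :
  (forall k t, nrm (radial f t (radius k) - vpoly (m k) c ((radius k)%:C%C * expi t)) <=
     k.+1%:R^-1) ->
  radial f t r @[r --> 1^'-] --> l ->
  nrm (vpoly (m k) c ((radius k)%:C%C * expi t)) ^+ 2 @[k --> \oo] --> nrm l ^+ 2.
Proof.
move=> hm fl.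
have h : nrm (vpoly (m k) c ((radius k)%:C%C * expi t)) @[k --> \oo] --> nrm l.
  apply: cvg_nrm; apply/cvg_nrmP.
  have h1 : nrm (radial f t (radius k) - l) @[k --> \oo] --> (0 : R).
    by apply/cvg_nrmP; apply: cvg_comp fl; exact: radius_at_left.
  have h2 : k.+1%:R^-1 + nrm (radial f t (radius k) - l) @[k --> \oo] --> (0 : R).
    rewrite -[X in _ --> X]addr0; apply: cvgD => //; exact: cvg_harmonic.
  apply: squeeze_cvgr h2; last exact: cvg_cst.
  near=> k; rewrite nrm_ge0 /=; apply: le_trans (nrm_tri _ (radial f t (radius k)) _) _.
  by rewrite lerD2r nrm_distC.
exact: (cvgM h h).
Unshelve. all: by end_near. Qed.

(** The square integrals of the approximants tend to [0] by dominated
    convergence, and they bound each coefficient from above. *)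
Lemma boundary_zero f c (b : R) : disc_series f c ->
  (forall z, nrm z < 1 -> nrm (f z) <= b) ->
  {ae mu, forall t, radial f t r @[r --> 1^'-] --> (0 : H)} ->
  forall n, c n = 0.
Proof.
move=> hf hb h0 n.
have [m hm] := approximants hf.
have hm2 k t := (hm k).2 t.
pose g k t : R := nrm (vpoly (m k) c ((radius k)%:C%C * expi t)) ^+ 2.
have gE k : g k = fun t => nrm (vpoly (m k) (fun n => (radius k ^+ n)%:C%C *: c n) (expi t)) ^+ 2.
  by apply/funext => t; rewrite /g vpoly_dilate.
have cg k : continuous (g k) by rewrite gE; exact: vpoly_sqr_continuous hH _ _.
pose D := `[(- pi)%R, (- pi + pi *+ 2 *+ 1)%R]%classic : set R.
have mD : measurable D by exact: measurable_itv.
have gb k t : `|g k t| <= (b + 1) ^+ 2.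
  rewrite ger0_norm ?sqr_ge0 // /g.
  have h1 : nrm (vpoly (m k) c ((radius k)%:C%C * expi t)) <= b + 1.
    have := hm2 k t.
    have /andP[r0 r1] := radius_itv k.
    have := hb ((radius k)%:C%C * expi t); rewrite nrm_real_expi // => /(_ r1).
    have k1 : (k.+1%:R : R)^-1 <= 1 by rewrite invf_ple ?posrE // invr1 ler1n.
    have := nrm_tri (vpoly (m k) c ((radius k)%:C%C * expi t)) (radial f t (radius k)) 0.
    rewrite !subr0 (nrm_distC (vpoly _ _ _)) /radial.
    by move: k1; move: (k.+1%:R^-1) => u; lra.
  by rewrite ler_sqr ?nnegrE ?nrm_ge0 // (le_trans (nrm_ge0 _) h1).
have [|||||_ _ lim] := @dominated_convergence _ _ R mu D mD (fun k t => (g k t)%:E) (cst 0%E)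
   (cst ((b + 1) ^+ 2)%:E).
- move=> k; apply: measurable_funTS; apply: measurableT_comp => //.
  exact: continuous_measurable_fun.
- exact: measurable_cst.
- apply: (@filterS _ _ (ae_filter_ringOfSetsType mu)) h0 => t h _; apply: cvg_EFin; first by near=> k.
  have := approximant_cvg hm2 h.
  by rewrite nrm0 expr0n.
- apply: (@continuous_compact_integrable R (cst ((b + 1) ^+ 2))).
    exact: segment_compact.
  by apply: continuous_subspaceT => x; exact: cvg_cst.
- by apply: aeW => t k _ /=; rewrite lee_fin.
rewrite integral_cst // mul0e in lim.
pose T : R := pi *+ 2 *+ 1.
have T0 : 0 < T by rewrite /T mulr1n -mulr_natr mulr_gt0 ?pi_gt0.
have intE k : (\int[mu]_(t in D) (g k t)%:E =
    (T * \sum_(i < m k) nrm ((radius k ^+ i)%:C%C *: c i) ^+ 2)%R%:E)%E.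
  by rewrite gE; apply: (parseval hH).
have lim2 : T * \sum_(i < m k) nrm ((radius k ^+ i)%:C%C *: c i) ^+ 2 @[k --> \oo]
    --> (0 : R).
  rewrite (_ : (fun k => _) = fine \o (fun k => \int[mu]_(t in D) (g k t)%:E)%E).
    exact: fine_cvg lim.
  by apply/funext => k /=; rewrite intE.
have lim3 : T * (radius k ^+ n * nrm (c n)) ^+ 2 @[k --> \oo] --> T * (1 * nrm (c n)) ^+ 2.
  apply: cvgMl_tmp.
  have h : radius k ^+ n * nrm (c n) @[k --> \oo] --> 1 * nrm (c n).
    by apply: cvgMr_tmp; exact: radiusX_cvg.
  exact: (cvgM h h).
have : T * (1 * nrm (c n)) ^+ 2 <= 0.
  apply: (ler_cvg_to lim3 lim2); near=> k.
  rewrite ler_pM2l //.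
  have nk : (n < m k)%N.
    apply: leq_trans (hm k).1; near: k; exact: nbhs_infty_gt.
  rewrite (bigD1 (Ordinal nk)) //= nrmZ nrmC ger0_norm ?lerDl ?sumr_ge0 //.
    by move=> i _; rewrite sqr_ge0.
  by rewrite exprn_ge0 //; case/andP: (radius_itv k).
rewrite mul1r pmulr_rle0 // => h.
have : nrm (c n) ^+ 2 = 0 by apply/eqP; rewrite eq_le h sqr_ge0.
by move/eqP; rewrite sqrf_eq0 nrm_eq0 => /eqP.
Unshelve. all: by end_near. Qed.

(** By Parseval the nonnegative functions [(b + 1/(k+1))^2 - |G_k|^2] built on
    the approximants [G_k] have integrals tending to [0].  Markov's inequality
    shows that their limit cannot be positive on a set of positive measure. *)
Lemma boundary_norm f c (b : R) : disc_series f c -> 0 <= b ->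
  (forall z, nrm z < 1 -> nrm (f z) <= b) ->
  (forall e, 0 < e -> exists N, b ^+ 2 - e <= \sum_(n < N) nrm (c n) ^+ 2) ->
  {ae mu, forall t, forall l : H, radial f t r @[r --> 1^'-] --> l -> nrm l = b}.
Proof.
move=> hf b0 hb hc; apply: ae_windows => j.
have [m hm] := approximants hf.
have hm2 k t := (hm k).2 t.
pose q k : R := k.+1%:R^-1.
have q0 k : 0 < q k by rewrite invr_gt0.
have ql : q k @[k --> \oo] --> (0 : R) by exact: cvg_harmonic.
pose g k t : R := nrm (vpoly (m k) c ((radius k)%:C%C * expi t)) ^+ 2.
have gE k : g k = fun t => nrm (vpoly (m k) (fun n => (radius k ^+ n)%:C%C *: c n) (expi t)) ^+ 2.
  by apply/funext => t; rewrite /g vpoly_dilate.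
have cg k : continuous (g k) by rewrite gE; exact: vpoly_sqr_continuous hH _ _.
pose h k t := (b + q k) ^+ 2 - g k t.
have h0 k t : 0 <= h k t.
  rewrite subr_ge0 /g ler_sqr ?nnegrE ?nrm_ge0 ?addr_ge0 // ?(ltW (q0 k)) //.
  have := hm2 k t.
  have /andP[r0 r1] := radius_itv k.
  have := hb ((radius k)%:C%C * expi t); rewrite nrm_real_expi // => /(_ r1).
  have := nrm_tri (vpoly (m k) c ((radius k)%:C%C * expi t)) (radial f t (radius k)) 0.
  by rewrite !subr0 (nrm_distC (vpoly _ _ _)) /radial -/(q k); lra.
have ch k : continuous (h k).
  by move=> t; apply: cvgB; [exact: cvg_cst|exact: cg].
pose T : R := pi *+ 2 *+ j.+1.
have T0 : 0 < T by rewrite /T -mulr_natr mulr_gt0 // -mulr_natr mulr_gt0 ?pi_gt0.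
pose D := `[(- pi *+ j.+1)%R, (- pi *+ j.+1 + T)%R]%classic : set R.
have mD : measurable D by exact: measurable_itv.
have sE M k : 0 <= \sum_(i < M) nrm ((radius k ^+ i)%:C%C *: c i) ^+ 2.
  by apply: sumr_ge0 => i _; exact: sqr_ge0.
pose I k : R := T * ((b + q k) ^+ 2 -
  \sum_(i < m k) nrm ((radius k ^+ i)%:C%C *: c i) ^+ 2).
have muD : mu D = T%:E.
  by rewrite /D lebesgue_measure_itv /= lte_fin ltrDl T0 -EFinD addrAC subrr add0r.
have mh k : measurable_fun D (EFin \o h k).
  by apply: measurable_funTS; apply: measurableT_comp => //; exact: continuous_measurable_fun.
have mg k : measurable_fun D (EFin \o g k).
  by apply: measurable_funTS; apply: measurableT_comp => //; exact: continuous_measurable_fun.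
have intE k : (\int[mu]_(t in D) (h k t)%:E = (I k)%:E)%E.
  have : (\int[mu]_(t in D) (h k t)%:E + \int[mu]_(t in D) (g k t)%:E =
     ((b + q k) ^+ 2 * T)%R%:E)%E.
    have hge0 t : D t -> (0 <= (EFin \o h k) t)%E by rewrite /= lee_fin.
    have gge0 t : D t -> (0 <= (EFin \o g k) t)%E by rewrite /= lee_fin sqr_ge0.
    rewrite -(ge0_integralD mu mD hge0 (mh k) gge0 (mg k)).
    rewrite (eq_integral (cst ((b + q k) ^+ 2)%:E)).
      by rewrite integral_cst // (EFinM ((b + q k) ^+ 2) T) -muD.
    by move=> t _ /=; rewrite -EFinD /h subrK.
  have -> : (\int[mu]_(t in D) (g k t)%:E =
     (T * \sum_(i < m k) nrm ((radius k ^+ i)%:C%C *: c i) ^+ 2)%R%:E)%E.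
    by rewrite gE; apply: (parseval hH).
  set y := (\int[mu]_(t in D) (h k t)%:E)%E; case: y => [x| |] //.
  rewrite -EFinD => -[] hx; congr EFin; rewrite /I mulrBr [T * (b + _) ^+ 2]mulrC -hx.
  by rewrite addrK.
have Ismall e : 0 < e -> exists K, forall k, (K <= k)%N -> I k <= e.
  move=> e0; have [N hN] := hc (e / 2 / T) (divr_gt0 (divr_gt0 e0 (ltr0n _ 2)) T0).
  pose u k : R := T * ((b + q k) ^+ 2 - \sum_(i < N) (radius k ^+ i * nrm (c i)) ^+ 2).
  pose l : R := T * ((b + 0) ^+ 2 - \sum_(i < N) (1 * nrm (c i)) ^+ 2).
  have ul : u k @[k --> \oo] --> l.
    apply: cvgMl_tmp; apply: cvgB.
      have hq : b + q k @[k --> \oo] --> b + 0 by apply: cvgD => //; exact: cvg_cst.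
      exact: (cvgM hq hq).
    apply: cvg_big; first exact: add_continuous.
    move=> i _; have hr : radius k ^+ i * nrm (c i) @[k --> \oo] --> 1 * nrm (c i).
      by apply: cvgMr_tmp; exact: radiusX_cvg.
    exact: (cvgM hr hr).
  have le : l < e.
    rewrite /l addr0; under eq_bigr do rewrite mul1r.
    rewrite -ltr_pdivlMl // mulrC; have e2 : e / 2 / T < e / T.
      by rewrite ltr_pM2r ?invr_gt0 //; lra.
    move: hN e2; move: (e / 2 / T) (e / T) (\sum_(n < N) nrm (c n) ^+ 2) => x1 x2 x3; lra.
  have [K _ hK] := cvgr_lt _ ul _ le.
  exists (maxn K N) => k; rewrite geq_max => /andP[Kk Nk].
  apply: le_trans (ltW (hK k Kk)); rewrite /I /u ler_pM2l // lerD2l lerN2.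
  have Nm : (N <= m k)%N by apply: leq_trans Nk (hm k).1.
  rewrite -(subnKC Nm) big_split_ord /=; apply: ler_wpDr.
    by apply: sumr_ge0 => i _; exact: sqr_ge0.
  apply: ler_sum => i _; rewrite nrmZ nrmC ger0_norm //.
  by rewrite exprn_ge0 //; case/andP: (radius_itv k).
have hlim t (l : H) : radial f t r @[r --> 1^'-] --> l ->
    h k t @[k --> \oo] --> b ^+ 2 - nrm l ^+ 2.
  move=> fl; rewrite -[in X in _ --> X](addr0 b); apply: cvgB.
    have hq : b + q k @[k --> \oo] --> b + 0 by apply: cvgD => //; exact: cvg_cst.
    exact: (cvgM hq hq).
  exact: approximant_cvg fl.
pose E (p : nat) := [set t | `|t| <= pi *+ j /\ exists2 l : H,
  radial f t r @[r --> 1^'-] --> l & p.+1%:R^-1 < b ^+ 2 - nrm l ^+ 2].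
set X := [set t | _].
have sub : X `<=` \bigcup_p E p.
  move=> t [tj /existsNP [l] /not_implyP [fl lb]].
  have hl0 : 0 <= b ^+ 2 - nrm l ^+ 2.
    apply: (ler_cvg_to (cvg_cst 0) (hlim t l fl)); near=> k; exact: h0.
  have hl1 : 0 < b ^+ 2 - nrm l ^+ 2.
    rewrite lt_def hl0 andbT subr_eq0 eqrXn2 ?nrm_ge0 //.
    by apply/negP => /eqP h1; apply: lb.
  exists (Num.trunc (b ^+ 2 - nrm l ^+ 2)^-1) => //; split=> //; exists l => //.
  by rewrite invf_plt ?posrE // truncnS_gt.
apply: (@negligibleS _ _ _ mu _ _ sub); apply: negligible_bigcup => p.
apply: negligible_eps => e e0.
have p0 : 0 < (p.+1%:R : R)^-1 by rewrite invr_gt0.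
have [K hK] := Ismall _ (mulr_gt0 p0 e0).
pose W n := D `&` [set t | (p.+1%:R^-1%:E <= `|(h (K + n)%N t)%:E|)%E].
have mW n : measurable (W n).
  apply: emeasurable_fun_c_infty => //.
  by apply: measurableT_comp => //; exact: mh.
have bW n : (mu (W n) <= e%:E)%E.
  have := le_integral_abse mu mD (mh (K + n)%N) p0.
  under eq_integral do rewrite /= ger0_norm //.
  rewrite intE => hh.
  have := le_trans hh (_ : _ <= (p.+1%:R^-1 * e)%:E)%E.
  rewrite lee_fin hK ?leq_addr // => /(_ isT).
  by rewrite EFinM lee_pmul2l.
have [mU bU] := measure_liminf_le mW bW.
exists (\bigcup_K0 \bigcap_(n >= K0) W n); split=> //.
move=> t [tj [l fl hl]].
have [K1 _ hK1] := cvgr_gt _ (hlim t l fl) _ hl.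
exists K1 => // n /= K1n; split.
  rewrite /D /= in_itv /=; move: tj; rewrite ler_norml => /andP[t1 t2].
  have pp := pi_gt0 R.
  have PE : T = pi *+ j.+1 + pi *+ j.+1 by rewrite /T mulrnAC mulr2n.
  rewrite PE mulNrn addrA addNr add0r; move: t1 t2; rewrite mulrS.
  by move=> t1 t2; apply/andP; split; lra.
rewrite /= lee_fin ger0_norm //; apply/ltW/hK1; exact: leq_trans K1n (leq_addl _ _).
Unshelve. all: by end_near. Qed.

End BoundaryNorm.

(** * Images and preimages of closed subspaces *)

Section ClosureImages.
Context {R : realType} {H : completeNormedModType R[i]}.
Variable dot : {dot H for Num.conj}.
Hypothesis hH : hilbert dot.
Implicit Types (M : set H) (x y : H).

Lemma preimage_subspace M (A : H -> H) C : closed_subspace M -> linear A ->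
  bounded_by C A -> closed_subspace [set x | M (A x)].
Proof.
move=> cM lA bA; apply: closed_subspace_intro => /=.
- by rewrite (lin0 lA); exact: subs0.
- by move=> a x y hx hy; rewrite lA; apply: (subsZD cM).
- apply: closed_seqP => u l hu ul /=.
  apply: (subs_lim cM (F := \oo) (f := fun n => A (u n))).
    by near=> n; exact: hu.
  exact: (cvg_op lA bA ul).
Unshelve. all: by end_near. Qed.

Lemma closure_nrmP (A : set H) x :
  closure A x <-> (forall e : R, 0 < e -> exists2 y, A y & nrm (x - y) < e).
Proof.
split=> [cx e e0|h B /nbhs_ballP[e e0 hB]].
  have := cx (ball x (e : R)%:C%C); case; first by apply: nbhsx_ballx; rewrite ltcR.
  by move=> y [Ay]; rewrite -ball_normE /= nrmE ltcR => ?; exists y.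
have eE : e = (complex.Re e)%:C%C by rewrite RRe_real ?gtr0_real.
have e0' : 0 < complex.Re e by rewrite -ltcR -eE.
have [y Ay hy] := h _ e0'; exists y; split=> //; apply: hB.
by rewrite -ball_normE /= nrmE eE ltcR.
Qed.

Lemma closure_image_subspace M (A : H -> H) : closed_subspace M -> linear A ->
  closed_subspace (closure (A @` M)).
Proof.
move=> cM lA; apply: closed_subspace_intro; last exact: closed_closure.
  by apply: subset_closure; exists 0; [exact: subs0|exact: lin0].
move=> a x y /closure_nrmP hx /closure_nrmP hy; apply/closure_nrmP => e e0.
have n0 : 0 < 2 * (nrm a + 1) by rewrite mulr_gt0 // ltr_wpDl // nrm_ge0.
have [_ [x' Mx <-] xx] := hx _ (divr_gt0 e0 n0).
have [_ [y' My <-] yy] := hy _ (divr_gt0 e0 (ltr0n _ 2)).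
exists (a *: A x' + A y').
  by exists (a *: x' + y'); [apply: (subsZD cM)|rewrite lA].
rewrite opprD addrACA -scalerBr; apply: le_lt_trans (nrmD _ _) _; rewrite nrmZ.
have h : nrm a * nrm (x - A x') <= e / 2.
  apply: (@le_trans _ _ ((nrm a + 1) * (e / (2 * (nrm a + 1))))).
    by apply: ler_pM; rewrite ?nrm_ge0 ?lerDl // ltW.
  rewrite le_eqVlt; apply/orP; left; apply/eqP.
  have := nrm_ge0 a; move: (nrm a) => q q0; field.
  by rewrite gt_eqF // ltr_wpDl.
by rewrite [e in X in _ < X]splitr; apply: ler_ltD.
Qed.

Lemma orthocomp_self M x : M x -> orthocomp dot M x -> x = 0.
Proof.
move=> Mx /(_ x Mx) h; apply/eqP; rewrite -nrm_eq0 -sqrf_eq0 -(ip_nrm hH) /ip h.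
by [].
Qed.

Lemma nontrivial_exists M : closed_subspace M -> M <> [set 0] ->
  exists2 x, M x & x != 0.
Proof.
move=> cM h; apply: contrapT => h2; apply: h; apply/seteqP; split=> [x Mx|x ->].
  by have [//|x0] := eqVneq x 0; exfalso; apply: h2; exists x.
exact: subs0.
Qed.

End ClosureImages.

(** * The boundary operator at one point of the circle *)

Section BoundaryOperator.
Context {R : realType} {H : completeNormedModType R[i]}.
Variable dot : {dot H for Num.conj}.
Hypothesis hH : hilbert dot.
Implicit Types (x y l : H) (t r : R) (z : R[i]).
Local Notation mu := (@lebesgue_measure R).

Definition boundary_value T t x l : Prop :=
  radial_char_fun dot T t x r @[r --> 1^'-] --> l.

(** Existence of the boundary value is part of the notion. *)
Definition isometric_at T t x : Prop :=
  exists2 l, boundary_value T t x l & nrm l = nrm x.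

Lemma boundary_value_unique T t x l l' :
  boundary_value T t x l -> boundary_value T t x l' -> l = l'.
Proof. by move=> h h'; rewrite -(cvg_lim _ h) // (cvg_lim _ h'). Qed.

Section Pair.
Context {T S : H -> H}.
Hypothesis TS : adjoint_contractions dot T S.

(** An operator with an adjoint is linear. *)
Lemma char_fun_linear z : nrm z < 1 -> linear (char_fun dot T z).
Proof.
move=> z1 a x y; apply: (dot_inj hH) => w; rewrite dotC [RHS]dotC; congr (_^*)%C.
by rewrite [RHS]dotDl [X in _ = X + _]dotZl !(char_fun_adjoint hH _ _ TS z1) dotDl dotZl.
Qed.

Lemma near_radius (P : R -> Prop) : (forall r, 0 <= r -> r < 1 -> P r) ->
  \forall r \near (1 : R)^'-, P r.
Proof.
move=> h; near=> r; apply: h.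
  by near: r; apply: nbhs_left_ge; exact: ltr01.
by near: r; exact: nbhs_left_lt.
Unshelve. all: by end_near. Qed.

Lemma boundary_value_linear a t x y l k : boundary_value T t x l ->
  boundary_value T t y k -> boundary_value T t (a *: x + y) (a *: l + k).
Proof.
move=> hx hy; rewrite /boundary_value.
have h : a *: radial_char_fun dot T t x r + radial_char_fun dot T t y r
    @[r --> 1^'-] --> a *: l + k by apply: cvgD => //; exact: cvgZl_tmp.
apply: cvg_trans h; apply: near_eq_cvg; apply: near_radius => r r0 r1.
by rewrite /radial_char_fun char_fun_linear // nrm_real_expi.
Qed.

Lemma boundary_value_bounded t x l : boundary_value T t x l -> nrm l <= nrm x.
Proof.
move=> hx; apply: (ler_cvg_to (cvg_nrm hx) (cvg_cst (nrm x))).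
apply: near_radius => r r0 r1; apply: (char_fun_contr hH TS).
by rewrite nrm_real_expi.
Qed.

(** Where it exists the boundary operator is a contraction.  For a contraction
    the vectors whose norm is preserved form a subspace, by the parallelogram
    identity applied before and after. *)
Lemma isometric_subspace t : closed_subspace (isometric_at T t).
Proof.
have Z a x : isometric_at T t x -> isometric_at T t (a *: x).
  move=> [l hl nl]; exists (a *: l); last by rewrite !nrmZ nl.
  have h0 : boundary_value T t 0 0.
    have := boundary_value_linear (a := -1) hl hl.
    by rewrite !scaleN1r !addNr.
  by have := boundary_value_linear (a := a) hl h0; rewrite !addr0.
apply: closed_subspace_intro.
- exists 0; last by rewrite !nrm0.
  have h : cvg_to (cst (0 : H) @ (1 : R)^'-) (nbhs (0 : H)) by exact: cvg_cst.
  apply: cvg_trans h; apply: near_eq_cvg; apply: near_radius => r r0 r1.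
  by rewrite /radial_char_fun (lin0 (char_fun_linear _)) // nrm_real_expi.
- move=> a x y /(Z a) [l hl nl] [k hk nk].
  move: (a *: x) hl nl => {}x hl nl; exists (l + k).
    by have := boundary_value_linear (a := 1) hl hk; rewrite !scale1r.
  have h1 : nrm (l + k) <= nrm (x + y).
    apply: (boundary_value_bounded (t := t)).
    by have := boundary_value_linear (a := 1) hl hk; rewrite !scale1r.
  have h2 : nrm (k - l) <= nrm (y - x).
    apply: (boundary_value_bounded (t := t)).
    have := boundary_value_linear (a := -1) hl hk; rewrite !scaleN1r.
    by rewrite ![- _ + _]addrC.
  have h3 := parallelogram hH x y; have h4 := parallelogram hH l k.
  rewrite (nrm_distC x y) in h3; rewrite (nrm_distC l k) nl nk in h4.
  have s1 : nrm (l + k) ^+ 2 <= nrm (x + y) ^+ 2 by rewrite ler_sqr ?nnegrE ?nrm_ge0.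
  have s2 : nrm (k - l) ^+ 2 <= nrm (y - x) ^+ 2 by rewrite ler_sqr ?nnegrE ?nrm_ge0.
  apply/eqP; rewrite -(@eqrXn2 _ 2) ?nrm_ge0 //; apply/eqP; lra.
- apply: closed_seqP => u x hu ux.
  have near_u e : 0 < e -> exists n, nrm (u n - x) < e.
    move=> e0; have /cvg_nrmP/cvgrPdist_lt := ux => /(_ e e0) [N _ hN].
    exists N; have := hN N (leqnn N).
    by rewrite sub0r normrN ger0_norm ?nrm_ge0.
  have step n l : boundary_value T t (u n) l -> forall e, 0 < e ->
      \forall r \near (1 : R)^'-, nrm (l - radial_char_fun dot T t x r) < e + nrm (u n - x).
    move=> hl e e0; have /cvg_nrmP/cvgrPdist_lt := hl => /(_ e e0) hl2.
    have hc : \forall r \near (1 : R)^'-, nrm (radial_char_fun dot T t (u n) r -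
        radial_char_fun dot T t x r) <= nrm (u n - x).
      apply: near_radius => r r0 r1; rewrite /radial_char_fun.
      rewrite -(linB (char_fun_linear _)) ?nrm_real_expi //.
      by apply: (char_fun_contr hH TS); rewrite nrm_real_expi.
    near=> r; apply: le_lt_trans (nrm_tri _ (radial_char_fun dot T t (u n) r) _) _.
    apply: ltr_leD; last by near: r.
    rewrite nrm_distC; have -> : nrm (radial_char_fun dot T t (u n) r - l) =
        `|0 - nrm (radial_char_fun dot T t (u n) r - l)|.
      by rewrite sub0r normrN ger0_norm ?nrm_ge0.
    by near: r; exact: hl2.
  have [l hl] : exists l : H, boundary_value T t x l.
    suff : cvg (radial_char_fun dot T t x r @[r --> 1^'-]) by move/cvg_ex.
    apply: cauchy_cvg; apply: cauchy_exP => eps eps0.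
    have eE : eps = (complex.Re eps)%:C%C by rewrite RRe_real ?gtr0_real.
    have e0 : 0 < complex.Re eps / 2 by rewrite divr_gt0 // -ltcR -eE.
    have [n hn] := near_u _ e0; have [l hl _] := hu n; exists l.
    have := step n l hl _ e0; apply: filterS => r hr.
    by rewrite -ball_normE /= nrmE eE ltcR [complex.Re eps]splitr; lra.
  exists l => //; apply/eqP; rewrite -subr_eq0 -normr_eq0 eq_le normr_ge0 andbT.
  apply/ler_addgt0Pr => e e0; rewrite add0r.
  have e2 : 0 < e / 2 by rewrite divr_gt0.
  have [n hn] := near_u _ e2; have [k hk nk] := hu n.
  have hkl : nrm (k - l) <= nrm (u n - x).
    apply: (boundary_value_bounded (t := t)).
    have := boundary_value_linear (a := -1) hl hk; rewrite !scaleN1r.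
    by rewrite ![- _ + _]addrC.
  have := nrm_dist l k; have := nrm_dist (u n) x.
  rewrite (nrm_distC l k) -nk => a1 a2.
  have -> : nrm l - nrm x = (nrm l - nrm k) + (nrm k - nrm x) by ring.
  apply: le_trans (ler_normD _ _) _.
  by move: a1 a2 hkl hn; move: `|_ - _| `|_ - _| => b1 b2; lra.
Unshelve. all: by end_near. Qed.

End Pair.
End BoundaryOperator.

(** * Cyclic reducing subspaces *)

Section CyclicSubspace.
Context {R : realType} {H : completeNormedModType R[i]}.
Variable dot : {dot H for Num.conj}.
Hypothesis hH : hilbert dot.
Implicit Types (x y : H).

Definition word (T S : H -> H) x (w : seq bool) : H :=
  foldr (fun b y => if b then T y else S y) x w.

(** The closed span of the orbit of [x] under words in [T] and [S], described as
    an intersection so that a property holds on it as soon as it defines a closed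
    subspace and holds at the countably many words. *)
Definition cyclic (T S : H -> H) x : set H :=
  [set y | forall K, closed_subspace K -> (forall w, K (word T S x w)) -> K y].

Context {T S : H -> H}.
Hypothesis TS : adjoint_contractions dot T S.

Lemma cyclic_closed_subspace x : closed_subspace (cyclic T S x).
Proof.
apply: closed_subspace_intro.
- by move=> K cK _; exact: subs0.
- by move=> a u v hu hv K cK hw; apply: (subsZD cK); [exact: hu|exact: hv].
- apply: closed_seqP => u l hu ul K cK hw.
  by apply: (subs_lim cK _ ul); near=> n; exact: hu.
Unshelve. all: by end_near. Qed.

Lemma cyclic_base x : cyclic T S x x.
Proof. by move=> K _ /(_ [::]). Qed.

Lemma cyclic_stable x y : cyclic T S x y -> cyclic T S x (T y) /\ cyclic T S x (S y).
Proof.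
case: TS => lT bT lS bS _ hy; split=> K cK hw.
  apply: (hy [set y | K (T y)] (preimage_subspace cK lT bT)) => w.
  exact: hw (true :: w).
apply: (hy [set y | K (S y)] (preimage_subspace cK lS bS)) => w.
exact: hw (false :: w).
Qed.

Lemma cyclic_min x M : closed_subspace M -> M x -> (forall y, M y -> M (T y)) ->
  (forall y, M y -> M (S y)) -> cyclic T S x `<=` M.
Proof.
move=> cM Mx hT hS y; apply=> // w; elim: w => //= b w ih.
by case: b; [exact: hT|exact: hS].
Qed.

Lemma orthocomp_stable M : (forall y, M y -> M (S y)) ->
  forall y, orthocomp dot M y -> orthocomp dot M (T y).
Proof.
case: TS => _ _ _ _ aT hS y oy x Mx.
by rewrite dotC aT -dotC; apply: dot_eq0C; rewrite dotC oy ?conjc0 //; exact: hS.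
Qed.

Lemma reducing_reducible M : closed_subspace M -> nontrivial_in [set: H] M ->
  (forall y, M y -> M (T y)) -> (forall y, M y -> M (S y)) -> reducible dot T.
Proof.
move=> cM nM hT hS; exists M; split=> //.
  by move=> _ [y My <-]; exact: hT.
by move=> _ [y My <-]; exact: orthocomp_stable.
Qed.

End CyclicSubspace.

(** * Boundary values of the characteristic function *)

Section BoundaryUnitary.
Context {R : realType} {H : completeNormedModType R[i]}.
Variable dot : {dot H for Num.conj}.
Hypothesis hH : hilbert dot.
Implicit Types (x y l : H) (t r : R) (z : R[i]).
Local Notation mu := (@lebesgue_measure R).

Definition strongly_null (A : H -> H) := forall x, iter n A x @[n --> \oo] --> (0 : H).

Section Pair.
Context {T S : H -> H}.
Hypothesis TS : adjoint_contractions dot T S.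
Hypothesis S0 : strongly_null S.

Lemma char_fun_series x :
  disc_series (fun z => char_fun dot T z x) (char_coef T S x).
Proof. by exists (nrm x) => z M z1; exact: (char_fun_tail hH TS). Qed.

Lemma char_coef_sum_le x M : \sum_(k < M) nrm (char_coef T S x k) ^+ 2 <= nrm x ^+ 2.
Proof.
case: M => [|M]; first by rewrite big_ord0 sqr_ge0.
by rewrite (char_coef_sum hH TS) lerBlDr lerDl sqr_ge0.
Qed.

Lemma char_coef_sum_ge x e : 0 < e ->
  exists N, nrm x ^+ 2 - e <= \sum_(k < N) nrm (char_coef T S x k) ^+ 2.
Proof.
move=> e0.
have h : nrm (iter n S (defect T S x)) @[n --> \oo] --> (0 : R).
  by rewrite -(@nrm0 R H); apply: cvg_nrm; exact: S0.
have h2 : nrm (iter n S (defect T S x)) ^+ 2 @[n --> \oo] --> (0 * 0 : R).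
  exact: (cvgM h h).
rewrite mulr0 in h2.
have [N _ hN] := cvgr_lt _ h2 _ e0.
exists N.+1; rewrite (char_coef_sum hH TS) lerD2l lerN2.
exact/ltW/(hN N (leqnn N)).
Qed.

(** The squares of the coefficients at [x] add up to [|x|^2], which is also the
    square of the bound for the function. *)
Lemma ae_isometric_at x : {ae mu, forall t, isometric_at dot T t x}.
Proof.
have F := ae_filter_ringOfSetsType mu.
have h1 := fatou_radial hH (char_fun_series x) (char_coef_sum_le x).
have h2 := boundary_norm hH (char_fun_series x) (nrm_ge0 x)
  (fun z => @char_fun_contr _ _ _ hH _ _ TS z x) (@char_coef_sum_ge x).
apply: (@filterS2 _ _ F _ _ _ _ h1 h2) => t /cvg_ex [l hl] hn.
by exists l => //; exact: hn.
Qed.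

(** Words are countable, and the vectors at which the boundary operator exists
    and is isometric form a closed subspace. *)
Lemma ae_isometric_cyclic (A B : H -> H) x :
  {ae mu, forall t, cyclic A B x `<=` isometric_at dot T t}.
Proof.
have F := ae_filter_ringOfSetsType mu.
pose P (n : nat) t := if unpickle n is Some w then isometric_at dot T t (word A B x w)
  else True.
have : {ae mu, forall t, forall n, P n t}.
  apply: ae_foralln => n; rewrite /P; case: (unpickle n) => [w|].
    exact: ae_isometric_at.
  by apply: aeW.
apply: (@filterS _ _ F) => t ht y; apply; first exact: (isometric_subspace hH TS).
by move=> w; have := ht (pickle w); rewrite /P pickleK.
Qed.

(** The characteristic function of [S] is evaluated at [- t], the argument of the
    conjugate point. *)
Lemma boundary_value_adjoint t x y l k : boundary_value dot T t x l ->
  boundary_value dot S (- t) y k -> dot l y = dot x k.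
Proof.
move=> hl hk.
have key x' l' : boundary_value dot T t x' l' -> ip dot l' y = ip dot x' k.
  move=> hl'.
  have h1 : ip dot (radial_char_fun dot T t x' r) y @[r --> 1^'-] --> ip dot l' y.
    exact: (cvg_ipl hH hl').
  have h2 : ip dot x' (radial_char_fun dot S (- t) y r) @[r --> 1^'-] --> ip dot x' k.
    exact: (cvg_ipr hH hk).
  rewrite -(cvg_lim _ h1) //; apply: cvg_lim => //.
  apply: cvg_trans h2; apply: near_eq_cvg; apply: near_radius => r r0 r1.
  rewrite /radial_char_fun /ip (char_fun_adjoint hH _ _ TS) ?nrm_real_expi //.
  by congr (complex.Re (dot _ (char_fun _ _ _ _))); rewrite cosN sinN; simpc.
have h0 : boundary_value dot T t 0 0.
  have := boundary_value_linear hH TS (a := -1) hl hl.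
  by rewrite !scaleN1r !addNr.
rewrite !dot_ip (key _ _ hl); congr (_ +i* - _)%C; apply: key.
by have := boundary_value_linear hH TS (a := 'i%C) hl h0; rewrite !addr0.
Qed.

(** Apply [boundary_zero] to the scalar function [dot (Theta(z) x) y], turned into
    a vector-valued one by multiplying it by [y]. *)
Lemma weak_uniqueness x y :
  {ae mu, forall t, exists2 l, boundary_value dot T t x l & dot l y = 0} ->
  forall n, dot (char_coef T S x n) y = 0.
Proof.
move=> hae.
have F := ae_filter_ringOfSetsType mu.
have [->|y0] := eqVneq y 0; first by move=> n; rewrite dot0r.
pose c n := dot (char_coef T S x n) y *: y.
have bnd u : nrm (dot u y *: y) <= nrm u * (nrm y * nrm y).
  by rewrite nrmZ mulrA ler_wpM2r ?nrm_ge0 //; exact: cauchy_schwarz.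
have vE M z : vpoly M c z = dot (vpoly M (char_coef T S x) z) y *: y.
  rewrite /vpoly dot_suml scaler_suml; apply: eq_bigr => k _.
  by rewrite /c scalerA.
have ser : disc_series (fun z => dot (char_fun dot T z x) y *: y) c.
  exists (nrm x * (nrm y * nrm y)) => z M z1; rewrite vE -scalerBl -dotBl.
  apply: le_trans (bnd _) _; rewrite mulrAC ler_wpM2r ?mulr_ge0 ?nrm_ge0 //.
  exact: (char_fun_tail hH TS).
have cb z : nrm z < 1 ->
    nrm (dot (char_fun dot T z x) y *: y) <= nrm x * (nrm y * nrm y).
  move=> z1; apply: le_trans (bnd _) _; rewrite ler_wpM2r ?mulr_ge0 ?nrm_ge0 //.
  exact: (char_fun_contr hH TS).
have c0 := boundary_zero hH ser cb.
move=> n; apply/eqP; have /eqP : c n = 0; last first.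
  by rewrite /c scaler_eq0 (negbTE y0) orbF.
apply: c0; apply: (@filterS _ _ F) hae => t [l hl ly]; apply/cvg_nrmP.
have h : nrm (radial_char_fun dot T t x r - l) * (nrm y * nrm y) @[r --> 1^'-] --> (0 : R).
  rewrite -[X in _ --> X](mul0r (nrm y * nrm y)); apply: cvgMr_tmp.
  by apply/cvg_nrmP; exact: hl.
apply: squeeze_cvgr h; last exact: cvg_cst.
near=> r; rewrite nrm_ge0 subr0 /=; apply: le_trans (bnd _).
by rewrite dotBl ly subr0.
Unshelve. all: by end_near. Qed.

End Pair.
End BoundaryUnitary.

Lemma closure_sub_closed (X : topologicalType) (A B : set X) :
  A `<=` B -> closed B -> closure A `<=` B.
Proof. by move=> AB cB; apply: subset_trans cB; exact: closure_subset. Qed.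

Section Reflection.
Context {R : realType}.
Local Notation mu := (@lebesgue_measure R).

(** Lebesgue measure is invariant under reflection. *)
Lemma ae_opp (P : R -> Prop) :
  {ae mu, forall t, P t} -> {ae mu, forall t, P (- t)}.
Proof.
move=> [A [mA A0 sub]]; exists (-%R @^-1` A); split.
- rewrite -[X in measurable X]setTI.
  exact: (@oppr_measurable R setT measurableT A mA).
- have := lebesgue_measureN mA; rewrite /pushforward => h.
  by apply: etrans h _; exact: A0.
- by move=> t nPt; apply: sub.
Qed.

End Reflection.

Section Main.
Context {R : realType} {H : completeNormedModType R[i]}.
Variable dot : {dot H for Num.conj}.
Hypothesis hH : hilbert dot.
Implicit Types (x y l : H) (t r : R) (z : R[i]) (K : set H).
Local Notation mu := (@lebesgue_measure R).

(** Where [D] vanishes [T] is isometric, so [|T^n x| = |x|] although [T^n x]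
    tends to [0]. *)
Lemma defect_kernel_trivial (T S : H -> H) K : adjoint_contractions dot T S ->
  strongly_null T -> (forall x, K x -> K (T x)) ->
  (forall x, K x -> defect T S x = 0) -> K `<=` [set 0].
Proof.
move=> TS T0 hT hD x Kx.
have h n : K (iter n T x) /\ nrm (iter n T x) = nrm x.
  elim: n => [|n [Kn ih]] //=; split; first exact: hT.
  have := nrm_defect hH TS (iter n T x); rewrite hD // nrm0 expr0n /= ih => h.
  apply/eqP; rewrite -(@eqrXn2 _ 2) ?nrm_ge0 //; apply/eqP; lra.
have h1 : nrm (iter n T x) @[n --> \oo] --> (0 : R).
  by rewrite -(@nrm0 R H); apply: cvg_nrm; exact: T0.
have h2 : nrm (iter n T x) @[n --> \oo] --> nrm x.
  by apply: cvg_near_cst; near=> n; exact: (h n).2.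
apply/eqP; rewrite -nrm_eq0 -(cvg_lim _ h2) // (cvg_lim _ h1) //.
Unshelve. all: by end_near. Qed.

Lemma char_fun_mem (T S : H -> H) F z x : adjoint_contractions dot T S ->
  closed_subspace F -> (forall n, F (char_coef T S x n)) -> nrm z < 1 ->
  F (char_fun dot T z x).
Proof.
move=> TS cF hF z1.
have vF M : F (vpoly M (char_coef T S x) z).
  rewrite /vpoly; elim: M => [|M ih]; first by rewrite big_ord0; exact: subs0.
  by rewrite big_ord_recr; apply: (subsD cF) => //; apply: (subsZ cF).
have lim : vpoly M (char_coef T S x) z @[M --> \oo] --> char_fun dot T z x.
  apply/cvg_nrmP; pose C := nrm x / (1 - nrm z).
  have h : nrm z ^+ M * C @[M --> \oo] --> (0 : R).
    rewrite -[X in _ --> X](mul0r C); apply: cvgMr_tmp; apply: cvg_expr.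
    by rewrite ger0_norm ?nrm_ge0.
  apply: squeeze_cvgr h; last exact: cvg_cst.
  near=> M; rewrite nrm_ge0 nrm_distC; apply: le_trans (char_fun_tail hH TS _ _ z1) _.
  by rewrite /C mulrCA.
by apply: (subs_lim cF _ lim); near=> M; exact: vF.
Unshelve. all: by end_near. Qed.

(** * From a reducing subspace to constant boundary images *)

Section Forward.
Context {T S : H -> H}.
Hypothesis TS : adjoint_contractions dot T S.
Variable K : set H.
Hypotheses (cK : closed_subspace K) (KT : forall x, K x -> K (T x))
  (KS : forall x, K x -> K (S x)).

Lemma defect_image_sub : closure (defect T S @` K) `<=` K.
Proof.
case: (cK) => _ clK; apply: closure_sub_closed => //.
by move=> _ [x Kx <-]; apply: (defect_stable TS).
Qed.

(** [T D = D' T] settles the constant coefficient; the others are in the range of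
    [D'] on [K]. *)
Lemma char_coef_image x n : closure (defect T S @` K) x ->
  closure (defect S T @` K) (char_coef T S x n).
Proof.
have ST := adjoint_contractionsC TS.
have lD' : linear (defect S T) by exact: defect_linear ST.
have cE' := closure_image_subspace cK lD'.
move=> Ex; case: n => [|n] /=; last first.
  apply: subset_closure; exists (iter n S (defect T S x)) => //.
  have : K (defect T S x) by apply: (defect_stable TS) => //; exact: defect_image_sub.
  by elim: n => //= n ih Kx; exact/KS/ih.
apply: (subsN cE'); case: (TS) => lT bT _ _ _.
have cP : closed_subspace [set x | closure (defect S T @` K) (T x)].
  exact: preimage_subspace bT.
suff : closure (defect T S @` K) `<=` [set x | closure (defect S T @` K) (T x)].
  exact.
case: cP => _ clP; apply: closure_sub_closed => // _ [w Kw <-] /=.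
rewrite (defect_intertwine TS); apply: subset_closure; exists (T w) => //; exact: KT.
Qed.

Lemma boundary_value_image t x l : closure (defect T S @` K) x ->
  boundary_value dot T t x l -> closure (defect S T @` K) l.
Proof.
have ST := adjoint_contractionsC TS.
have cE' := closure_image_subspace cK (defect_linear ST).
move=> Ex hl; apply: (subs_lim cE' _ hl); apply: near_radius => r r0 r1.
apply: (char_fun_mem TS) => //; last by rewrite nrm_real_expi.
by move=> n; exact: char_coef_image.
Qed.

(** If the closure of [D K] were the whole defect space, [D] would vanish on the
    complement of [K], which is invariant under [T] as well. *)
Lemma defect_image_nontrivial : strongly_null T -> nontrivial_in [set: H] K ->
  nontrivial_in (closure (range (defect T S))) (closure (defect T S @` K)).
Proof.
move=> T0 [K0 KH]; split=> hE.
  apply: K0; apply/seteqP; split=> [|x ->]; last exact: subs0.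
  apply: (defect_kernel_trivial TS T0 KT) => x Kx.
  by have : closure (defect T S @` K) (defect T S x);
    [apply: subset_closure; exists x|rewrite hE].
have [y [oy y0]] := nontrivial_orthocomp hH cK KH.
have := @defect_kernel_trivial T S (orthocomp dot K) TS T0.
move=> /(_ _ _ y oy) /= h; move/eqP : y0; apply; apply: h.
  by move=> x; apply: (orthocomp_stable TS).
move=> x ox; apply: (orthocomp_self hH (M := K)).
  apply: defect_image_sub; rewrite hE; apply: subset_closure; by exists x.
move=> k Kk; rewrite -(defect_selfadjoint hH TS); apply: ox.
exact: (defect_stable TS).
Qed.

End Forward.

(** The boundary operators of [T] and [S] are isometric and adjoint to each
    other, so the second one provides preimages for the first. *)
Lemma boundary_maps_defect_images (T S : H -> H) K t :
  adjoint_contractions dot T S -> closed_subspace K ->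
  (forall x, K x -> K (T x)) -> (forall x, K x -> K (S x)) ->
  K `<=` isometric_at dot T t -> K `<=` isometric_at dot S (- t) ->
  boundary_maps_onto dot T t (closure (defect T S @` K)) (closure (defect S T @` K)).
Proof.
move=> TS cK KT KS isoT isoS; split.
  by move=> x /(defect_image_sub TS cK KT KS) /isoT [l hl _]; apply/cvg_ex; exists l.
have ST := adjoint_contractionsC TS.
apply/seteqP; split=> [_ [x Ex <-]|y Ey].
  have [l hl _] := isoT _ (defect_image_sub TS cK KT KS Ex).
  by rewrite /boundary_char_fun (cvg_lim _ hl) //; exact: (boundary_value_image TS cK KT KS Ex hl).
have [k hk nk] := isoS _ (defect_image_sub ST cK KS KT Ey).
have Ek : closure (defect T S @` K) k by exact: (boundary_value_image ST cK KS KT Ey hk).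
have [l hl nl] := isoT _ (defect_image_sub TS cK KT KS Ek).
exists k => //; rewrite /boundary_char_fun (cvg_lim _ hl) //.
have ip1 : ip dot l y = nrm k ^+ 2.
  by rewrite -(ip_nrm hH) /ip (boundary_value_adjoint hH TS hl hk).
apply/eqP; rewrite -subr_eq0 -nrm_eq0 -sqrf_eq0 (nrm_sqB hH) ip1 nl -nk.
by apply/eqP; ring.
Qed.

(** The given reducing subspace is replaced by a cyclic one inside it, on which
    the almost everywhere statements hold for all vectors at once. *)
Theorem reducible_boundary_maps (T S : H -> H) : adjoint_contractions dot T S ->
  strongly_null T -> strongly_null S -> reducible dot T ->
  exists K, [/\ closed_subspace K, nontrivial_in [set: H] K,
    forall x, K x -> K (T x), forall x, K x -> K (S x) &
    {ae mu, forall t, K `<=` isometric_at dot T t /\ K `<=` isometric_at dot S (- t)}].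
Proof.
move=> TS T0 S0 [M [cM [M0 MH] MT MoT]].
have ST := adjoint_contractionsC TS.
have hMT x : M x -> M (T x) by move=> Mx; apply: MT; exists x.
have hMS x : M x -> M (S x).
  move=> Mx; apply: (bicomplement hH cM) => y oy.
  have [_ _ _ _ aT] := TS.
  by rewrite -aT; apply: dot_eq0C; apply: (MoT (T y)) => //; exists y.
have [x Mx x0] := nontrivial_exists cM M0.
have KM : cyclic T S x `<=` M by exact: cyclic_min.
exists (cyclic T S x); split.
- exact: cyclic_closed_subspace.
- split=> hK.
    have : cyclic T S x x by exact: cyclic_base.
    by rewrite hK => /= hx; move/eqP : x0; exact.
  by apply: MH; apply/seteqP; split=> // y _; apply: KM; rewrite hK.
- by move=> y /(cyclic_stable TS) [].
- by move=> y /(cyclic_stable TS) [].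
have F := ae_filter_ringOfSetsType mu.
have h1 := ae_isometric_cyclic hH TS S0 T S x.
have h2 := ae_opp (ae_isometric_cyclic hH ST T0 T S x).
by apply: (@filterS2 _ _ F _ _ _ _ h1 h2) => t ? ?; split.
Qed.

(** * From constant boundary images to a reducing subspace *)

Section Backward.
Context {T S : H -> H}.
Hypothesis TS : adjoint_contractions dot T S.
Let ST := adjoint_contractionsC TS.
Local Notation D := (defect T S).
Local Notation D' := (defect S T).
Variables E E' : set H.
Hypotheses (cE : closed_subspace E) (cE' : closed_subspace E').
Hypothesis coefE : forall x n, E x -> E' (char_coef T S x n).
Hypothesis coefF : forall x n, orthocomp dot E x ->
  orthocomp dot E' (char_coef T S x n).

Let aT x y : dot (T x) y = dot x (S y). Proof. by case: TS. Qed.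

Lemma T_maps_E x : E x -> E' (T x).
Proof. by move=> Ex; rewrite -[T x]opprK; apply: (subsN cE'); exact: (coefE 0). Qed.

Lemma DSnD_maps_E n x : E x -> E' (D' (iter n S (D x))).
Proof. exact: (coefE n.+1). Qed.

Lemma S_maps_E' y : E' y -> E (S y).
Proof.
move=> Ey; apply: (bicomplement hH cE) => f fo; rewrite -aT.
apply: dot_eq0C; have := coefF 0 fo Ey; rewrite /= dotNr => /eqP.
by rewrite oppr_eq0 => /eqP.
Qed.

Lemma iter_adjoint n x y : dot (iter n S x) y = dot x (iter n T y).
Proof.
elim: n x y => //= n ih x y.
by rewrite [LHS]dotC -aT -dotC ih -iterSr.
Qed.

Lemma DTnD'_maps_E' n y : E' y -> E (D (iter n T (D' y))).
Proof.
move=> Ey; apply: (bicomplement hH cE) => f fo.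
rewrite -(defect_selfadjoint hH TS) -iter_adjoint -(defect_selfadjoint hH ST).
by apply: dot_eq0C; exact: (coefF n.+1 fo Ey).
Qed.

(** By definition of the coefficients, this is the orthogonal complement of all
    [S^n D F] and [T^n D' F'] with [F] and [F'] the complements of [E] and
    [E']. *)
Definition reducing_part : set H :=
  [set x | forall n, E (D (iter n T x)) /\ E' (D' (iter n S x))].

Lemma iter_lin_bounded n (A : H -> H) : linear A -> bounded_by 1 A ->
  linear (iter n A) /\ bounded_by 1 (iter n A).
Proof.
move=> lA bA; elim: n => [|n [l b]] /=; first by split=> // x; rewrite mul1r.
by split=> [a x y|x] /=; [rewrite l lA|have := bA (iter n A x); have := b x; lra].
Qed.

Lemma reducing_part_closed : closed_subspace reducing_part.
Proof.
have [lT bT lS bS _] := TS.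
have c1 n : closed_subspace [set x | E (D (iter n T x))].
  have [l b] := iter_lin_bounded n lT bT.
  apply: (preimage_subspace (A := iter n T) (M := [set x | E (D x)]) _ l b).
  exact: (preimage_subspace cE (defect_linear TS) (defect_bounded hH TS)).
have c2 n : closed_subspace [set x | E' (D' (iter n S x))].
  have [l b] := iter_lin_bounded n lS bS.
  apply: (preimage_subspace (A := iter n S) (M := [set x | E' (D' x)]) _ l b).
  exact: (preimage_subspace cE' (defect_linear ST) (defect_bounded hH ST)).
apply: closed_subspace_intro.
- by move=> n; split; [exact: (subs0 (c1 n))|exact: (subs0 (c2 n))].
- move=> a x y hx hy n; split.
    by apply: (subsZD (c1 n)); [case: (hx n)|case: (hy n)].
  by apply: (subsZD (c2 n)); [case: (hx n)|case: (hy n)].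
- apply: closed_seqP => u l hu ul n; split.
    by apply: (subs_lim (c1 n) _ ul); near=> k; case: (hu k n).
  by apply: (subs_lim (c2 n) _ ul); near=> k; case: (hu k n).
Unshelve. all: by end_near. Qed.

(** For [n > 0], [S T = I - D^2] lowers the power of [S] and leaves terms that
    the coefficients control. *)
Lemma reducing_partT x : reducing_part x -> reducing_part (T x).
Proof.
move=> hx n; split; first by rewrite -iterSr; case: (hx n.+1).
have [Ex _] := hx 0%N.
case: n => [|n] /=; first by rewrite -(defect_intertwine TS); exact: T_maps_E.
have [lS bS _ _ _] := ST; have [lD _] := iter_lin_bounded n lS bS.
have -> : S (iter n S (T x)) = iter n S x - iter n S (D (D x)).
  by rewrite -iterS iterSr -(linB lD) (defect_sqr TS) subKr.
rewrite (linB (defect_linear ST)); apply: (subsB cE'); first by case: (hx n).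
exact: DSnD_maps_E.
Qed.

Lemma reducing_partS x : reducing_part x -> reducing_part (S x).
Proof.
move=> hx n; split; last by rewrite -iterSr; case: (hx n.+1).
have [_ Ex] := hx 0%N.
case: n => [|n] /=; first by rewrite -(defect_intertwine ST); exact: S_maps_E'.
have [lT bT _ _ _] := TS; have [lD _] := iter_lin_bounded n lT bT.
have -> : T (iter n T (S x)) = iter n T x - iter n T (D' (D' x)).
  by rewrite -iterS iterSr -(linB lD) (defect_sqr ST) subKr.
rewrite (linB (defect_linear TS)); apply: (subsB cE); first by case: (hx n).
exact: DTnD'_maps_E'.
Qed.

(** These vectors show that the reducing subspace is nonzero. *)
Lemma reducing_part_defect x : E x -> reducing_part (D x).
Proof.
move=> Ex n; split; last exact: DSnD_maps_E.
case: n => [|n].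
  rewrite /= (defect_sqr TS); apply: (subsB cE) => //; exact/S_maps_E'/T_maps_E.
by rewrite iterSr (defect_intertwine TS); exact/DTnD'_maps_E'/T_maps_E.
Qed.

(** If [D] vanished on [E], then [E] would be orthogonal to the range of [D],
    whose closure contains it; if the reducing subspace were everything, [E]
    would contain the range of [D]. *)
Lemma coefficients_reducible :
  E `<=` closure (range D) -> nontrivial_in (closure (range D)) E ->
  reducible dot T.
Proof.
move=> sE [E0 Efull].
apply: (reducing_reducible TS reducing_part_closed) => [|x|x].
- split=> hM.
    have [e Ee e0] := nontrivial_exists cE E0.
    have De : D e = 0 by have := reducing_part_defect Ee; rewrite hM.
    move/eqP : e0; apply; apply: (orthocomp_self hH (M := E)) => // f /sE.
    have cP := orthocomp_closed hH [set e].
    suff : closure (range D) `<=` orthocomp dot [set e].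
      by move=> sub /sub /(_ e erefl) /dot_eq0C.
    case: cP => _ clP; apply: closure_sub_closed => // _ [w _ <-] _ ->.
    by rewrite -(defect_selfadjoint hH TS) De dot0l.
  apply: Efull; apply/seteqP; split=> //; case: (cE) => _ clE.
  apply: closure_sub_closed => // _ [w _ <-].
  have hw : reducing_part w by rewrite hM.
  by case: (hw 0%N).
- exact: reducing_partT.
- exact: reducing_partS.
Qed.

End Backward.

(** Either a cyclic subspace reduces [T], or almost every boundary operator is
    unitary on the whole space. *)
Theorem boundary_maps_reducible (T S : H -> H) (E E' : set H) :
  adjoint_contractions dot T S -> strongly_null T -> strongly_null S ->
  closed_subspace E -> closed_subspace E' ->
  E `<=` closure (range (defect T S)) ->
  nontrivial_in (closure (range (defect T S))) E ->
  {ae mu, forall t, boundary_maps_onto dot T t E E'} -> reducible dot T.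
Proof.
move=> TS T0 S0 cE cE' sE nE hae; have ST := adjoint_contractionsC TS.
have F := ae_filter_ringOfSetsType mu.
have [e Ee e0] := nontrivial_exists cE nE.1.
have [KH|KH] := pselect (cyclic T S e = [set: H]); last first.
  apply: (reducing_reducible TS (@cyclic_closed_subspace _ _ T S e)).
  - split=> // hK.
    have he : cyclic T S e e by exact: cyclic_base.
    by rewrite hK in he; move/eqP : e0; exact.
  - by move=> y /(cyclic_stable TS) [].
  - by move=> y /(cyclic_stable TS) [].
have h1 := ae_isometric_cyclic hH TS S0 T S e.
have h2 := ae_opp (ae_isometric_cyclic hH ST T0 T S e).
rewrite KH in h1 h2.
have onto t y : boundary_maps_onto dot T t E E' -> E' y ->
    exists2 x, E x & boundary_value dot T t x y.
  move=> [cv <-] [x Ex <-]; exists x => //; exact: cv.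
apply: (@coefficients_reducible T S TS E E' cE cE') => //.
- move=> x n Ex; apply: (bicomplement hH cE') => y oy.
  apply: dot_eq0C; apply: (weak_uniqueness hH TS).
  apply: (@filterS _ _ F) hae => t [cv im].
  have /cvg_ex [l hl] := cv x Ex; exists l => //.
  by apply: oy; rewrite -im; exists x => //; exact: cvg_lim.
- move=> x n ox y Ey; apply: dot_eq0C; apply: (weak_uniqueness hH TS).
  apply: (@filterS3 _ _ F _ _ _ _ _ hae h1 h2) => t ht isoT isoS.
  have [l hl _] := isoT x I; have [k hk nk] := isoS y I.
  exists l => //; rewrite (boundary_value_adjoint hH TS hl hk).
  have [w Ew hw] := onto t y ht Ey.
  have -> : k = w.
    have [w' hw' nw] := isoT w I.
    have wy := boundary_value_unique hw' hw; rewrite {}wy in hw' nw.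
    have ip1 : ip dot k w = nrm y ^+ 2.
      by rewrite ipC -(ip_nrm hH) /ip (boundary_value_adjoint hH TS hw hk).
    apply/eqP; rewrite -subr_eq0 -nrm_eq0 -sqrf_eq0 (nrm_sqB hH) ip1 nk -nw.
    by apply/eqP; ring.
  by apply: dot_eq0C; exact: ox.
Qed.

End Main.

Theorem corollary3p2 (R : realType) (H : completeNormedModType R[i])
    (dot : {dot H for Num.conj}) (hH : hilbert dot) (T : H -> H)
    (hT : C00 dot T) :
  reducible dot T <->
  exists E E' : set H,
    [/\ closed_subspace E, E `<=` defect_space dot T &
        nontrivial_in (defect_space dot T) E] /\
    [/\ closed_subspace E', E' `<=` defect_space dot (adjoint dot T) &
        nontrivial_in (defect_space dot (adjoint dot T)) E'] /\
    {ae lebesgue_measure, forall t : R, boundary_maps_onto dot T t E E'}.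
Proof.
have [cT T0 S0] := hT.
have TS := contraction_adjoint hH cT; set S := adjoint dot T in TS S0 *.
have ST := adjoint_contractionsC TS.
rewrite /defect_space (defect_op_pair hH TS) (defect_op_pair hH ST).
split=> [red|[E [E' [[cE sE nE] [[cE' _ _] hae]]]]].
  have [K [cK nK KT KS hae]] := reducible_boundary_maps hH TS T0 S0 red.
  exists (closure (defect T S @` K)), (closure (defect S T @` K)).
  split; [split|split; [split|]].
  - exact: closure_image_subspace cK (defect_linear TS).
  - exact/closure_subset/image_subset.
  - exact: (defect_image_nontrivial hH TS cK KT KS T0 nK).
  - exact: closure_image_subspace cK (defect_linear ST).
  - exact/closure_subset/image_subset.
  - exact: (defect_image_nontrivial hH ST cK KS KT S0 nK).
  - have F := ae_filter_ringOfSetsType (@lebesgue_measure R).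
    apply: (@filterS _ _ F) hae => t [isoT isoS].
    exact: (boundary_maps_defect_images hH TS cK KT KS isoT isoS).
exact: (boundary_maps_reducible hH TS T0 S0 cE cE' sE nE hae).
Qed.
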